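(* Consensus$_{s,\partial_{SH}}$ can be solved in $O(k^3n^2)$ time, and also in $O(|\Sigma|k^2n^2)$ time, where $k$ is the number of input strings and $n$ their length.
   Context: The swap at position $p$ exchanges the letters at $p,p+1$; a swap permutation is a set of swaps at positions pairwise differing by at least $2$; equal-length strings are matching if a swap permutation transforms one into the other. Swap distance $\partial_S(u,v)$: $+\infty$ if not matching, else the number of swaps in the unique swap permutation from $u$ to $v$ never swapping identical letters. Swap+Hamming distance $\partial_{SH}(u,v)=\min_t\big(\partial_S(u,t)+\partial_{Ham}(t,v)\big)$ with $\partial_{Ham}$ the Hamming distance. Consensus$_{s,\partial_{SH}}$: given $k$ strings $s_1,\dots,s_k$ over $\Sigma$ of length $n$ and an integer $D$, decide whether there is a string $s^*$ of length $n$ with $\sum_i\partial_{SH}(s_i,s^* )\le D$. *)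

(* Defs.v *)
From mathcomp Require Import all_boot.
Set Implicit Arguments. Unset Strict Implicit. Unset Printing Implicit Defensive.

Section Strings.
Variable T : finType.

(* Apply the swaps at the positions satisfying P (positions are 0-based;
   the swap at p exchanges the letters at p and p+1).  For a swap
   permutation (positions pairwise >= 2 apart) this is exactly the
   simultaneous application of all its swaps. *)
Fixpoint swapseq (P : pred nat) (i : nat) (u : seq T) {struct u} : seq T :=
  match u with
  | x :: ((y :: r) as u') =>
      if P i then y :: x :: swapseq P i.+2 r else x :: swapseq P i.+1 u'
  | _ => u
  end.

Definition swap_perm (n : nat) (P : {set 'I_n}) : bool :=
  [forall p in P, p.+1 < n] &&
  [forall p in P, forall q in P, (p != q) ==> ((p.+1 < q) || (q.+1 < p))].

Definition swap_pred (n : nat) (P : {set 'I_n}) : pred nat :=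
  fun m => m \in [seq val p | p in P].

Definition apply_swaps (u : seq T) (P : {set 'I_(size u)}) : seq T :=
  swapseq (swap_pred P) 0 u.

Definition no_ident_swap (u : seq T) (P : {set 'I_(size u)}) : bool :=
  [forall p in P, onth u p != onth u p.+1].

(* Swap distance: None stands for +infinity (u, v not matching);
   otherwise the number of swaps of the (unique) swap permutation from
   u to v never swapping identical letters. *)
Definition swap_dist (u v : seq T) : option nat :=
  if [pick P : {set 'I_(size u)} |
        [&& swap_perm P, no_ident_swap P & apply_swaps P == v]] is Some P
  then Some #|P| else None.

Definition ham (u v : seq T) : nat := count (fun xy => xy.1 != xy.2) (zip u v).

(* Swap+Hamming distance: min over t of d_S(u,t) + d_Ham(t,v), t ranging
   over the strings of length |u| (terms with d_S(u,t) = +oo never attain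
   the minimum; they are replaced by ham u v, which is the value of the
   term t = u, so the minimum is unchanged). *)
Definition sh_dist (u v : seq T) : nat :=
  \big[minn/ham u v]_(t : (size u).-tuple T)
     (if swap_dist u t is Some d then d + ham t v else ham u v).

Definition consensus_SH (k n D : nat) (S : 'I_k -> seq T) : bool :=
  [exists s : n.-tuple T, \sum_(i < k) sh_dist (S i) s <= D].
End Strings.

(*  Unit-cost RAM (Cook-Reckhow style): registers/memory indexed by nat *)
(*  holding nats, addition, truncated subtraction, indirect addressing, *)
(*  conditional jumps.  Each instruction costs one time unit.          *)
Inductive instr : Type :=
| IConst of nat & nat
| IAdd   of nat & nat & nat
| ISub   of nat & nat & nat
| ILoad  of nat & nat
| IStore of nat & nat
| IJz    of nat & nat
| IJmp   of nat
| IHalt.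

Definition memory := nat -> nat.
Definition upd (m : memory) (a v : nat) : memory :=
  fun x => if x == a then v else m x.

Definition config := (nat * memory)%type.

Definition halted (p : seq instr) (c : config) : bool :=
  if nth IHalt p c.1 is IHalt then true else false.

Definition step (p : seq instr) (c : config) : config :=
  let: (pc, m) := c in
  match nth IHalt p pc with
  | IConst d v => (pc.+1, upd m d v)
  | IAdd d a b => (pc.+1, upd m d (m a + m b))
  | ISub d a b => (pc.+1, upd m d (m a - m b))
  | ILoad d a => (pc.+1, upd m d (m (m a)))
  | IStore a s => (pc.+1, upd m (m a) (m s))
  | IJz r l => (if m r == 0 then l else pc.+1, m)
  | IJmp l => (l, m)
  | IHalt => (pc, m)
  end.

Definition run (p : seq instr) (t : nat) (c : config) : config := iter t (step p) c.

Definition decides_within (p : seq instr) (t : nat) (c : config) (b : bool) : Prop :=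
  exists t', t' <= t /\ halted p (run p t' c) /\ (run p t' c).2 0 = nat_of_bool b.

(* Input encoding of a Consensus instance: M[0]=k, M[1]=n, M[2]=D,
   M[3]=|Sigma|, M[4 + i*n + j] = code of the j-th letter of s_i
   (letters coded by 0..|Sigma|-1), all other cells 0; pc = 0. *)
Definition encode_input (T : finType) (k n D : nat) (S : 'I_k -> seq T) : config :=
  (0, fun x =>
        if x == 0 then k else if x == 1 then n else if x == 2 then D
        else if x == 3 then #|T| else
        let y := x - 4 in
        if (n == 0) then 0 else
        let i := y %/ n in let j := y %% n in
        if i < k then
          (if [pick i' : 'I_k | val i' == i] is Some i' then
             (if onth (S i') j is Some a then val (enum_rank a) else 0)
           else 0)
        else 0).

Definition solvable_in (f : nat -> nat -> nat -> nat) : Prop :=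
  exists (p : seq instr) (c : nat),
    forall (T : finType) (k n D : nat) (S : 'I_k -> seq T),
      (forall i, size (S i) = n) ->
      decides_within p (c * (f #|T| k n + 1)) (encode_input n D S)
                     (consensus_SH n D S).

(* Main.v *)
Require Import Defs.
From mathcomp Require Import all_boot.
From mathcomp Require Import zify.
Set Implicit Arguments. Unset Strict Implicit. Unset Printing Implicit Defensive.

(** A swap helps only when it repairs two mismatches at once, so the swap+Hamming distance is
    computed greedily from left to right: a position costs nothing if its letters agree or if it
    completes a swap with a previous position that is not itself swapped.  Two overlapping useful
    swaps force the consensus string to alternate, [v p = v p.+2].  Hence, reading the
    consensus string from a position where no swap is pending, some input pins its next two
    letters (or no swap occurs there), and until the string stops alternating the state of every
    input is determined by the starting point; when it stops, no pending swap matters any more.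
    This gives a right-to-left dynamic program with one entry per position and one per
    (position, input), each entry computed in time O(kn): in total O(k^2 n^2), which lies below
    both bounds because a nonempty input has [k >= 1] and [sigma >= 1].

    On the machine only cells 0 to 3 are not occupied by letters.  Replacing [k] and [n] by the
    single number [2 ^ k * (2 * n + 1)] frees enough cells to compute, and this number is itself
    an address beyond the input, so the low cells can be moved there to serve as registers. *)

(** * Greedy form of the swap+Hamming distance *)

Section GreedyDistance.
Variable T : eqType.
Implicit Types u v : seq T.

(** The tables are correct because every candidate for an entry is realised by some string, possibly
    at lower cost, and every string costs at least some candidate. Candidates may therefore
    overestimate: forbidding a swap never lowers the cost, so it is always allowed on the realising
    side. The uniqueness of the swap permutation is replaced by a count: a swap of distinct letters
    creates exactly two mismatches, so the end strings determine the number of swaps. The machine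
    only adds and subtracts. The code [2 ^ k * (2 * n + 1)] is chosen because doublings build it in
    place, with one auxiliary cell, and because stripping leading binary digits decodes it. Decoding
    takes time O(n(k + n)), which stays within O(k^2 n^2). *)

Fixpoint gdist u v : nat :=
  match u, v with
  | x :: us, y :: vs =>
      if x == y then gdist us vs else
      match us, vs with
      | x' :: us', y' :: vs' =>
          if (x == y') && (x' == y) then (gdist us' vs').+1
          else (gdist us vs).+1
      | _, _ => (gdist us vs).+1
      end
  | _, _ => 0
  end.

(** Dropping the first column may destroy a swap made there by the greedy rule, but the column left
    over then costs at most one on its own. This is the exchange estimate behind the optimality of
    the greedy rule. *)
Lemma gdist_cons_bounds x y u v :
  gdist u v <= gdist (x :: u) (y :: v) <= (x != y) + gdist u v.
Proof.
elim: u x y v => [|x' u IH] x y [|y' v] /=; try by case: (x == y).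
case: (eqVneq x y) => [_|_]; first by rewrite leqnn.
case: ((x == y') && _) => /=; last by rewrite add1n leqnSn leqnn.

have /andP[h1 h2] := IH x' y' v; rewrite !add1n !ltnS h1 andbT.
apply: leq_trans h2 _; by case: (x' != y').
Qed.

Lemma gdist_cons2 x y u a b v : gdist [:: x, y & u] [:: a, b & v] =
  if x == a then gdist (y :: u) (b :: v)
  else if (x == b) && (y == a) then (gdist u v).+1
  else (gdist (y :: u) (b :: v)).+1.
Proof. by []. Qed.

End GreedyDistance.

Lemma gdist_map (T T' : eqType) (f : T -> T') (u v : seq T) :
  injective f -> gdist (map f u) (map f v) = gdist u v.
Proof.
move=> finj; have [m] := ubnP (size u); elim: m u v => // m IH [|x u] [|y v] //= hm.
rewrite (inj_eq finj) !IH //.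
case: u v hm => [|x' u] [|y' v] //= hm.
by rewrite !(inj_eq finj) IH //; lia.
Qed.

(** * Swap permutations and the greedy value *)

Section SwapHamming.
Variable T : finType.
Implicit Types (u v : seq T) (P : pred nat).

Lemma ham_cons (x y : T) u v : ham (x :: u) (y :: v) = (x != y) + ham u v.
Proof. by []. Qed.

Lemma swapseq_cons2 P i (x y : T) u : swapseq P i [:: x, y & u] =
  if P i then [:: y, x & swapseq P i.+2 u] else x :: swapseq P i.+1 (y :: u).
Proof. by []. Qed.

Lemma size_swapseq P i u : size (swapseq P i u) = size u.
Proof.
have [m] := ubnP (size u); elim: m i u => // m IH i [|x [|y u]] // hm.
rewrite swapseq_cons2; case: (P i); [congr _.+2 | congr _.+1]; apply: IH;
  by move: hm => /=; lia.
Qed.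

Lemma swapseq_ext P Q i u :
  (forall p, i <= p -> P p = Q p) -> swapseq P i u = swapseq Q i u.
Proof.
have [m] := ubnP (size u); elim: m i u => // m IH i [|x [|y u]] // hm hPQ.
have hPQ' j : i <= j -> forall p, j <= p -> P p = Q p.
  by move=> hj p hp; apply: hPQ; lia.
by rewrite !swapseq_cons2 hPQ // !IH //; try (by apply: hPQ'; lia); move: hm => /=; lia.
Qed.

Lemma swapseq_pred0 i u : swapseq pred0 i u = u.
Proof. by elim: u i => [|x [|y u] IH] i //; rewrite swapseq_cons2 IH. Qed.

Fixpoint nswaps P (i : nat) u : nat :=
  match u with
  | x :: ((y :: r) as u') =>
      if P i then (nswaps P i.+2 r).+1 else nswaps P i.+1 u'
  | _ => 0
  end.

Lemma nswaps_cons2 P i (x y : T) u : nswaps P i [:: x, y & u] =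
  if P i then (nswaps P i.+2 u).+1 else nswaps P i.+1 (y :: u).
Proof. by []. Qed.

Lemma nswaps_ext P Q i u :
  (forall p, i <= p -> P p = Q p) -> nswaps P i u = nswaps Q i u.
Proof.
have [m] := ubnP (size u); elim: m i u => // m IH i [|x [|y u]] // hm hPQ.
have hPQ' j : i <= j -> forall p, j <= p -> P p = Q p.
  by move=> hj p hp; apply: hPQ; lia.
by rewrite !nswaps_cons2 hPQ // !IH //; try (by apply: hPQ'; lia); move: hm => /=; lia.
Qed.

Lemma nswaps_pred0 i u : nswaps pred0 i u = 0.
Proof. by elim: u i => [|x [|y u] IH] i //; rewrite nswaps_cons2 IH. Qed.

(** A swap that repairs both letters is matched or beaten by the greedy rule; one that leaves a
    mismatch costs at least two, which pays for treating its two columns separately. [P] may be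
    arbitrary: [swapseq] jumps over the position after each swap, and [nswaps] counts only the swaps
    really made. *)
Lemma gdist_le_swap P i u v : size u = size v ->
  gdist u v <= nswaps P i u + ham (swapseq P i u) v.
Proof.
have [m] := ubnP (size u); elim: m i u v => // m IH i [|x u] [|a v] // hm [hs].
case: u v hs hm => [|y u] [|b v] // hs hm; first by rewrite /= /ham /=; case: (x == a).
have /andP[_ B1] := gdist_cons_bounds x a (y :: u) (b :: v).
have /andP[_ B2] := gdist_cons_bounds y b u v.
rewrite [nswaps _ _ _]/= [swapseq _ _ _]/=; case: (P i).
  have IHu : gdist u v <= nswaps P i.+2 u + ham (swapseq P i.+2 u) v.
    by apply: IH; move: hs hm => /=; lia.
  rewrite !ham_cons.
  have : gdist (x :: y :: u) (a :: b :: v) <=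
         (gdist u v).+1 + (y != a) + (x != b).
    rewrite gdist_cons2; move: B2; case: (x == a); first by case: (y != b); lia.
    by case: (x == b); case: (y == a); case: (y != b) => /=; lia.
  lia.
rewrite ham_cons; apply: leq_trans B1 _; rewrite addnCA leq_add2l.
by apply: IH => //; move: hm => /=; lia.
Qed.

(** The conditions on [P] are those of a swap permutation that never swaps identical letters.
    Positions are absolute, starting at [i], so that the set found for the tail is extended without
    shifting it. *)
Lemma greedy_swap i u v : size u = size v -> exists P : pred nat,
  [/\ forall p, P p -> [/\ i <= p, p.+1 < i + size u,
                           onth u (p - i) != onth u (p - i).+1 & ~~ P p.+1]
    & nswaps P i u + ham (swapseq P i u) v <= gdist u v].
Proof.
have [m] := ubnP (size u); elim: m i u v => // m IH i [|x u] [|a v] // hm hs.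
  by exists pred0; split.
move: hs => [hs].
(* Common to the branches without a swap at [i]; [j] stands for the greedy value, which unfolds
   differently in each of them. *)
have skip : forall j, (x != a) + gdist u v <= j ->
   exists P : pred nat,
  [/\ forall p, P p -> [/\ i <= p, p.+1 < i + size (x :: u),
       onth (x :: u) (p - i) != onth (x :: u) (p - i).+1 & ~~ P p.+1]
    & nswaps P i (x :: u) + ham (swapseq P i (x :: u)) (a :: v) <= j].
  move=> j hj.
  have [||P [hP1 hP2]] := IH i.+1 u v; [by move: hm => /=; lia | by [] |].
  exists P; split=> [p hp|].
    have [h1 h2 h3 h4] := hP1 _ hp; split=> //=; try lia.
    by rewrite (_ : p - i = (p - i.+1).+1) //; lia.
  have hPi : P i = false by apply/negP => /hP1 []; lia.
  have -> : nswaps P i (x :: u) = nswaps P i.+1 u by case: (u) => //= y w; rewrite hPi.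
  have -> : swapseq P i (x :: u) = x :: swapseq P i.+1 u.
    by case: (u) => //= y w; rewrite hPi.
  rewrite ham_cons; lia.
case: (eqVneq x a) => [hxa|hxa].
  by apply: skip => /=; rewrite hxa eqxx.
case: u v hs hm skip => [|y u] [|b v] // hs hm skip.
  by apply: skip; rewrite /= (negbTE hxa).
case: (boolP ((x == b) && (y == a))) => [hsw|hsw]; last first.
  by apply: skip; rewrite /= (negbTE hxa) (negbTE hsw).
have [||P [hP1 hP2]] := IH i.+2 u v; [by move: hm => /=; lia | by move: hs => []|].
exists (fun p => (p == i) || P p); split=> [p|].
  case: (eqVneq p i) => [-> _|hpi] /=.
    rewrite subnn /=; split; try lia.
      case/andP: hsw => /eqP hx /eqP hy.
      apply: contra hxa; rewrite hy => /eqP [->]; exact: eqxx.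
    apply/negP => /orP[]; first lia.
    by move=> /hP1 []; lia.
  move=> hp; have [h1 h2 h3 h4] := hP1 _ hp; split; try lia.
    by rewrite (_ : p - i = (p - i.+2).+2) //; lia.
rewrite nswaps_cons2 swapseq_cons2 gdist_cons2 eqxx (negbTE hxa) hsw /= !ham_cons.
case/andP: hsw => -> ->.
rewrite (@swapseq_ext _ P) => [|p hp]; last by rewrite (_ : p == i = false) //; lia.
rewrite (@nswaps_ext _ P) => [|p hp]; last by rewrite (_ : p == i = false) //; lia.
lia.
Qed.

(** The swaps made are disjoint and each changes exactly two letters. Hence the number of swaps
    depends only on the two end strings, whichever swap permutation the [pick] in [swap_dist]
    returns. *)
Lemma ham_swapseq P i u :
  (forall p, P p -> i <= p -> p.+1 < i + size u ->
     onth u (p - i) != onth u (p - i).+1) ->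
  ham u (swapseq P i u) = (nswaps P i u).*2.
Proof.
have [m] := ubnP (size u); elim: m i u => // m IH i [|x [|y u]] // hm hP.
  by rewrite /= ham_cons eqxx.
rewrite [swapseq _ _ _]/= [nswaps _ _ _]/=; case: (boolP (P i)) => hPi.
  have hxy : x != y.
    by have := hP i hPi (leqnn i); rewrite subnn /= => h; apply: contra (h _) => [/eqP -> //|]; lia.
  rewrite !ham_cons hxy eq_sym hxy IH; first by rewrite doubleS.
    by move: hm => /=; lia.
  move=> p hp h1 h2; have := hP p hp.
  rewrite (_ : p - i = (p - i.+2).+2) /=; last lia.
  by apply; lia.
rewrite ham_cons eqxx IH //.
move=> p hp h1 h2; have := hP p hp.
rewrite (_ : p - i = (p - i.+1).+1) /=; last lia.
by move: h2 => /= h2; apply; lia.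
Qed.

Lemma nswaps_count P i u :
  (forall p, P p -> p.+1 < i + size u /\ ~~ P p.+1) ->
  nswaps P i u = count P (iota i (size u)).
Proof.
have [m] := ubnP (size u); elim: m i u => // m IH i [|x [|y u]] // hm hP.
  rewrite /=; case: (boolP (P i)) => // /hP [] /=; lia.
rewrite nswaps_cons2; case: (boolP (P i)) => hPi.
  have [_ /negbTE h] := hP _ hPi; rewrite /= hPi h IH //; first by move: hm => /=; lia.
  by move=> p /hP [] /=; split=> //; lia.
rewrite IH /= ?(negbTE hPi) //.
by move=> p /hP [] /=; split=> //; lia.
Qed.

Lemma swap_predE n (P : {set 'I_n}) (p : 'I_n) : swap_pred P p = (p \in P).
Proof. by rewrite /swap_pred (mem_image val_inj). Qed.

Lemma swap_predP n (P : {set 'I_n}) m :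
  swap_pred P m -> exists2 p : 'I_n, p \in P & m = p.
Proof. by move=> /imageP [p hp ->]; exists p. Qed.

Lemma swap_perm_sep n (P : {set 'I_n}) : swap_perm P ->
  forall p, swap_pred P p -> p.+1 < n /\ ~~ swap_pred P p.+1.
Proof.
case/andP=> /forall_inP h1 /forall_inP h2 p /swap_predP[q hq ->]; split; first exact: h1.
apply/negP => /swap_predP[r hr hqr].
have := h2 _ hq; move/forall_inP => /(_ r hr) /implyP.
by rewrite -val_eqE /= -hqr; lia.
Qed.

Lemma nswaps_card u (P : {set 'I_(size u)}) : swap_perm P ->
  nswaps (swap_pred P) 0 u = #|P|.
Proof.
move=> /swap_perm_sep h; rewrite nswaps_count //.
rewrite -val_enum_ord count_map cardE [in RHS]/enum_mem size_filter -enumT.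
by apply: eq_count => p /=; rewrite swap_predE.
Qed.

Lemma no_ident_swapP u (P : {set 'I_(size u)}) p : no_ident_swap P ->
  swap_pred P p -> onth u p != onth u p.+1.
Proof. by move=> /forall_inP h /swap_predP [q hq ->]; apply: h. Qed.

Lemma swap_dist_nswaps u v d (P : pred nat) : swap_dist u v = Some d ->
  (forall p, P p -> p.+1 < size u -> onth u p != onth u p.+1) ->
  v = swapseq P 0 u -> d = nswaps P 0 u.
Proof.
rewrite /swap_dist; case: pickP => // Q /and3P[hQ1 hQ2 /eqP hQ3] [<-] hP hv.
rewrite -nswaps_card //; apply: double_inj.
rewrite -ham_swapseq => [|p hp _ _]; last by rewrite subn0; apply: no_ident_swapP hp.
rewrite -ham_swapseq; first by rewrite -hv -hQ3.
by move=> p hp _ h; rewrite subn0; apply: hP.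
Qed.

Lemma bigminn_le (I : finType) (F : I -> nat) x0 (i : I) :
  \big[minn/x0]_j F j <= F i.
Proof.
have := mem_index_enum i; elim: (index_enum I) => // j s IH.
rewrite big_cons inE => /orP[/eqP ->|/IH]; lia.
Qed.

Lemma bigminn_ge (I : finType) (F : I -> nat) x0 m :
  m <= x0 -> (forall i, m <= F i) -> m <= \big[minn/x0]_j F j.
Proof.
by move=> h0 hF; elim/big_ind: _ => // x y; rewrite leq_min => -> ->.
Qed.

Lemma sh_distE u v : size u = size v -> sh_dist u v = gdist u v.
Proof.
move=> hs; apply/eqP; rewrite eqn_leq; apply/andP; split.
  have [P [hP1 hP2]] := greedy_swap 0 hs.
  pose t := in_tuple (swapseq P 0 u).
  have e : size (swapseq P 0 u) = size u by rewrite size_swapseq.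
  apply: leq_trans (bigminn_le _ _ (tcast e t)) _.
  rewrite val_tcast /=.
  case hd: swap_dist => [d|].
    rewrite (swap_dist_nswaps (P := P) hd) // => p /hP1 [_ _].
    by rewrite subn0.
  (* The swap distance cannot be infinite here: the greedy set itself is eligible for the [pick]. *)
  exfalso; move: hd; rewrite /swap_dist; case: pickP => // /(_ [set p : 'I_(size u) | P p]).
  set Q := [set _ | _].
  have hQ p : swap_pred Q p = P p.
    apply/idP/idP => [/swap_predP[q]|hp]; first by rewrite inE => ? ->.
    have hlt : p < size u by have [] := hP1 _ hp; lia.
    by rewrite -[p]/(val (Ordinal hlt)) swap_predE inE.
  rewrite /apply_swaps (@swapseq_ext _ P) // eqxx andbT => /negP [] //.
  apply/andP; split.
    apply/andP; split; apply/forall_inP => p; rewrite inE => hp.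
      by have [] := hP1 _ hp.
    apply/forall_inP => q; rewrite inE => hq; apply/implyP.
    rewrite -val_eqE /= => hpq.
    have [_ _ _ hp'] := hP1 _ hp; have [_ _ _ hq'] := hP1 _ hq.
    have h1 : val q != p.+1 by apply: contra hp' => /eqP <-.
    have h2 : val p != q.+1 by apply: contra hq' => /eqP <-.
    by move: h1 h2 => /=; lia.
  apply/forall_inP => p; rewrite inE => hp.
  by have [_ _ + _] := hP1 _ hp; rewrite subn0.
(* The default value and the terms at infinite swap distance equal [ham u v], the cost of the empty
   set of swaps. *)
have h0 : gdist u v <= ham u v.
  by have := gdist_le_swap pred0 0 hs; rewrite nswaps_pred0 swapseq_pred0.
apply: bigminn_ge => // t.
rewrite /swap_dist; case: pickP => // Q /and3P[hQ1 hQ2 /eqP hQ3].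
by rewrite -nswaps_card // -hQ3; apply: gdist_le_swap.
Qed.

End SwapHamming.

(** * Scanning one input against a candidate *)

Section Scan.
Implicit Types (g v : nat -> nat) (b : bool).

(* The position [r] is scanned with candidate letters [x] at [r.-1] and [y] at [r]; the flag [b]
   says that a swap across the edge (r.-1, r) is unavailable, because [r.-1] is already swapped
   or because the scan starts at [r]. *)
Definition swp g b r x y := [&& ~~ b, g r.-1 == y & g r == x].
Definition charge g b r x y := (g r != y) && ~~ swp g b r x y.
Definition flag g b r x y := (g r != y) && swp g b r x y.

Fixpoint scan g v b r d : nat :=
  if d is d'.+1 then
    charge g b r (v r.-1) (v r) + scan g v (flag g b r (v r.-1) (v r)) r.+1 d'
  else 0.

Fixpoint flags g v b r d : bool :=
  if d is d'.+1 then flags g v (flag g b r (v r.-1) (v r)) r.+1 d' else b.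

Lemma scan_add g v b r d1 d2 :
  scan g v b r (d1 + d2) = scan g v b r d1 + scan g v (flags g v b r d1) (r + d1) d2.
Proof.
elim: d1 b r => [|d1 IH] b r /=; first by rewrite addn0.
by rewrite IH addnA addSnnS.
Qed.

Lemma scanS g v b r d : scan g v b r d.+1 =
  scan g v b r d + charge g (flags g v b r d) (r + d) (v (r + d).-1) (v (r + d)).
Proof. by rewrite -addn1 scan_add /= addn0. Qed.

Lemma flagsS g v b r d : flags g v b r d.+1 =
  flag g (flags g v b r d) (r + d) (v (r + d).-1) (v (r + d)).
Proof.
elim: d b r => [|d IH] b r; first by rewrite /= addn0.
by have := IH (flag g b r (v r.-1) (v r)) r.+1; rewrite addSnnS.
Qed.

Lemma scan_ext g v w b r d :
  (forall j, r.-1 <= j < r + d -> v j = w j) -> scan g v b r d = scan g w b r d.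
Proof.
elim: d b r => //= d IH b r h; rewrite (h r.-1) ?(h r); try lia.
by congr (_ + _); apply: IH => j hj; apply: h; lia.
Qed.

Lemma scan_blocked_ext g v w r d :
  (forall j, r <= j < r + d -> v j = w j) -> scan g v true r d = scan g w true r d.
Proof.
case: d => //= d h; rewrite /charge /flag /swp /= (h r); last lia.
by rewrite !andbF; congr (_ + _); apply: scan_ext => j hj; apply: h; lia.
Qed.

Lemma scan_flag g v b r d :
  (b -> ~~ ((g r.-1 == v r) && (g r == v r.-1))) ->
  scan g v b r d = scan g v false r d.
Proof. by case: b => // /(_ isT) h; case: d => //= d; rewrite /charge /flag /swp /= (negbTE h). Qed.

Lemma scan_noswap g v r d :
  ~~ ((g r.-1 == v r) && (g r == v r.-1)) -> scan g v false r d = scan g v true r d.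
Proof. by move=> h; rewrite [RHS]scan_flag // => _. Qed.

(** Both halves are proved together: a swap completed at [r] saves one unit but blocks the next
    edge, and the upper half bounds the price of that block by one. *)
Lemma scan_bounds g v r d :
  scan g v false r d <= scan g v true r d <= (scan g v false r d).+1.
Proof.
elim: d r => // d IH r /=; rewrite /charge /flag /swp /= !andbF !andbT.
have := IH r.+1; case: (g r != v r); case: ((g r.-1 == _) && _) => /=; lia.
Qed.

Lemma scan_le_blocked g v b r d : scan g v b r d <= scan g v true r d.
Proof. by case: b => //; have /andP[] := scan_bounds g v r d. Qed.

Lemma scan_blocked_cons g v r d :
  scan g v true r d.+1 = (g r != v r) + scan g v false r.+1 d.
Proof. by rewrite /= /charge /flag /swp /= andbT andbF. Qed.

(** If the swap pattern fits although the letters at [r.-1] agree, all four letters are equal and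
    nothing mismatches at [r]. So the scan, which goes on unblocked after a match, agrees with a
    fresh start. *)
Lemma scan_match g v r d : g r.-1 = v r.-1 -> scan g v false r d = scan g v true r d.
Proof.
move=> h; case: (boolP ((g r.-1 == v r) && (g r == v r.-1))) => [|/scan_noswap //].
case/andP => /eqP h1 /eqP h2; case: d => //= d.
by rewrite /charge /flag /swp h2 -h h1 eqxx.
Qed.

(** The scan pays for a swap at its first position and gets the second one free; the flag left there
    blocks the next edge, which amounts to the greedy restart behind the swap. *)
Lemma gdist_scan g v r d :
  gdist (map g (iota r d)) (map v (iota r d)) = scan g v true r d.
Proof.
have [m] := ubnP d; elim: m r d => // m IH r [|d] // hm.
rewrite scan_blocked_cons [iota _ _]/= [map g _]/= [map v _]/=.
case: (eqVneq (g r) (v r)) => [hr|hr].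
  by rewrite /= hr eqxx IH // scan_match.
case: d hm => [|d] hm; first by rewrite /= (negbTE hr).
rewrite [iota _ _]/= [map g _]/= [map v _]/= gdist_cons2 (negbTE hr) add1n.
case: (boolP ((g r == v r.+1) && (g r.+1 == v r))) => hs; last first.
  rewrite scan_noswap // -IH //; lia.
rewrite IH; last by lia.
rewrite /= /charge /flag /swp /= hs andbF andbT.
suff -> : g r.+1 != v r.+1 by [].
by case/andP: hs => /eqP <- /eqP ->; rewrite eq_sym.
Qed.

End Scan.
(** * The dynamic program *)

Section DynamicProgram.
Variables (k n sigma : nat) (s : nat -> nat -> nat).
Hypothesis s_lt : forall i j, s i j < sigma.
Implicit Types (v : nat -> nat).

Definition letters v := forall j, v j < sigma.

Definition total_cost v (b : nat -> bool) r d := \sum_(i < k) scan (s i) v (b i) r d.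

(** The flag [xpredT] makes [l] a fresh start, so the entry does not depend on what precedes it. The
    lower bound ranges over arbitrary sequences; only the witness has to consist of letters. *)
Definition suffix_opt l c :=
  (forall v, c <= total_cost v xpredT l (n - l)) /\
  exists v, letters v /\ total_cost v xpredT l (n - l) <= c.

(* Input [i] pins the letters [v l] and [v l.+1] to its own, swapped.  The first disjunct of the
   witness part gives up all swaps across the edge (l, l.+1) and then leaves [v l.+1] free. *)
Definition edge_opt l i c :=
  (forall v, v l = s i l.+1 -> v l.+1 = s i l -> c <= total_cost v xpred0 l.+1 (n - l.+1)) /\
  exists v, [/\ letters v, v l = s i l.+1 &
    total_cost v xpredT l.+1 (n - l.+1) <= c \/
    v l.+1 = s i l /\ total_cost v xpred0 l.+1 (n - l.+1) <= c].

Definition altern (x y l j : nat) : nat := if odd (j - l) then y else x.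

(** Candidate sets are predicates, so that a loop invariant can enlarge them one value at a time. *)
Definition is_min (P : nat -> Prop) c := P c /\ forall c', P c' -> c <= c'.

Lemma is_min_step P Q c c' : is_min P c ->
  (forall x, Q x <-> P x \/ x = c') -> is_min Q (minn c c').
Proof.
move=> [h1 h2] hQ; split.
  rewrite hQ; case: leqP => h; [by left | by right].
move=> x /hQ [/h2|->]; lia.
Qed.

Lemma is_min_ext P Q c : is_min P c -> (forall x, Q x <-> P x) -> is_min Q c.
Proof. by move=> [h1 h2] hQ; split=> [|x /hQ]; [apply/hQ | apply: h2]. Qed.

Definition mism l x := \sum_(i < k) (s i l != x).

Variables (C : nat -> nat) (R : nat -> nat -> nat).

(** The letter at [l] occurs in no input there, or is the letter of some input, or is swapped into
    [l] by some input. The first kind is charged [k] whatever the letter, so the alphabet is never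
    enumerated. *)
Definition suffix_cand l m c :=
  c = C l.+1 + k \/ exists2 i, i < m &
   (c = mism l (s i l) + C l.+1 \/ c = mism l (s i l.+1) + R l i).

(** An entry for the edge at [l] never pays for position [l], whose mismatches are charged wherever
    the entry is used; hence the count starts at [l.+1]. *)
Definition run_cost l i r :=
  total_cost (altern (s i l.+1) (s i l) l) xpred0 l.+1 (r - l).

(* The alternation is left at [r] for the pair pinned by [i2]; the inequality ensures that the
   swaps pending at [r] cannot compete with those of the new run. *)
Definition edge_leave l i r m c :=
  exists2 i2, i2 < m & [/\ s i2 r.+1 = altern (s i l.+1) (s i l) l r,
     s i2 r != altern (s i l.+1) (s i l) l r.-1 & c = run_cost l i r + R r i2].

Definition edge_cand l i m c :=
  c = C l.+1 \/ exists2 r, l < r < m & (c = run_cost l i r + C r.+1 \/ edge_leave l i r k c).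

Lemma total_nil v b r : total_cost v b r 0 = 0.
Proof. by rewrite /total_cost big1. Qed.

Lemma suffix_opt_n : 0 < sigma -> suffix_opt n 0.
Proof.
move=> h; split=> [v //|]; exists (fun=> 0); split=> [j //|].
by rewrite subnn total_nil.
Qed.

Lemma total_ext v w b r d :
  (forall j, r.-1 <= j < r + d -> v j = w j) -> total_cost v b r d = total_cost w b r d.
Proof. by move=> h; apply: eq_bigr => i _; apply: scan_ext. Qed.

Lemma total_blocked_ext v w r d :
  (forall j, r <= j < r + d -> v j = w j) ->
  total_cost v xpredT r d = total_cost w xpredT r d.
Proof. by move=> h; apply: eq_bigr => i _; apply: scan_blocked_ext. Qed.

Lemma total_le_blocked v b r d : total_cost v b r d <= total_cost v xpredT r d.
Proof. by apply: leq_sum => i _; apply: scan_le_blocked. Qed.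

Lemma total_add v b r d1 d2 : total_cost v b r (d1 + d2) =
  total_cost v b r d1 + total_cost v (fun i => flags (s i) v (b i) r d1) (r + d1) d2.
Proof. by rewrite /total_cost -big_split; apply: eq_bigr => i _; rewrite scan_add. Qed.

Lemma total_blocked_cons v r d :
  total_cost v xpredT r d.+1 = mism r (v r) + total_cost v xpred0 r.+1 d.
Proof.
by rewrite /total_cost /mism -big_split; apply: eq_bigr => i _; rewrite scan_blocked_cons.
Qed.

Lemma mism_le r x : mism r x <= k.
Proof.
apply: (@leq_trans (\sum_(i < k) 1)); last by rewrite sum1_card card_ord.
by apply: leq_sum => i _; case: (_ != _).
Qed.

(** If no input fits a swap across the edge, blocking the edge changes nothing; otherwise a fitting
    input dictates both letters. This is why one edge entry per input suffices. *)
Lemma total_fresh_cases v l d :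
  total_cost v xpred0 l.+1 d = total_cost v xpredT l.+1 d \/
  exists2 i, i < k & v l = s i l.+1 /\ v l.+1 = s i l.
Proof.
case: (boolP [exists i : 'I_k, (v l == s i l.+1) && (v l.+1 == s i l)]).
  by case/existsP=> i /andP[/eqP h1 /eqP h2]; right; exists i.
move=> h; left; apply: eq_bigr => i _; apply: scan_noswap => /=.
apply: contra h => /andP[/eqP h1 /eqP h2]; apply/existsP; exists i.
by rewrite h1 h2 !eqxx.
Qed.

Lemma suffix_optP l c : l < n -> suffix_opt l.+1 (C l.+1) ->
  (forall i, i < k -> edge_opt l i (R l i)) ->
  is_min (suffix_cand l k) c -> suffix_opt l c.
Proof.
move=> hl [C1 [w [hw hCw]]] hR [hc hmin].
have e : n - l = (n - l.+1).+1 by lia.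
split.
  move=> v; rewrite e total_blocked_cons.
  have [hf|[i hi [h1 h2]]] := total_fresh_cases v l (n - l.+1); last first.
    rewrite h1; apply: (@leq_trans (mism l (s i l.+1) + R l i)).
      by apply: hmin; right; exists i => //; right.
    by rewrite leq_add2l; have [+ _] := hR i hi; apply.
  rewrite hf; apply: (@leq_trans (mism l (v l) + C l.+1)); last by rewrite leq_add2l.
  case: (boolP [exists i : 'I_k, s i l == v l]) => [/existsP [i /eqP <-]|h].
    by apply: hmin; right; exists i => //; left.
  apply: (@leq_trans (C l.+1 + k)); first by apply: hmin; left.
  rewrite addnC leq_add2r.
  apply: (@leq_trans (\sum_(i < k) 1)); first by rewrite sum1_card card_ord.
  apply: leq_sum => i _; suff -> : s i l != v l by [].
  by apply: contra h => h; apply/existsP; exists i.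
have patch x : exists2 v, x < sigma -> letters v &
   [/\ v l = x, forall j, l < j -> v j = w j &
    total_cost v xpredT l (n - l) <= mism l x + C l.+1].
  exists (fun j => if j == l then x else w j); first by move=> hx j /=; case: ifP.
  split; [by rewrite eqxx | by move=> j hj; case: ifP => [/eqP|] //; lia |].
  rewrite e total_blocked_cons eqxx leq_add2l.
  apply: leq_trans (total_le_blocked _ _ _ _) _; apply: leq_trans hCw.
  by rewrite (@total_blocked_ext _ w) // => j hj; case: ifP => [/eqP|] //; lia.
case: hc => [->|[i hi [->|->]]].
(* Any letter realises this candidate, at cost at most [k] for position [l]; [s 0 l] is one at
   hand. *)
- have [v hv [h1 h2 h3]] := patch (s 0 l); exists v; split; first exact: hv.
  by apply: leq_trans h3 _; rewrite addnC leq_add2l mism_le.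
- by have [v hv [h1 h2 h3]] := patch (s i l); exists v; split=> //; apply: hv.
have [_ [v [hv hvl hor]]] := hR i hi; exists v; split=> //.
rewrite e total_blocked_cons hvl leq_add2l.
case: hor => [h|[_ //]]; exact: leq_trans (total_le_blocked _ _ _ _) h.
Qed.

Lemma altern0 x y l : altern x y l l = x.
Proof. by rewrite /altern subnn. Qed.

Lemma altern1 x y l : altern x y l l.+1 = y.
Proof. by rewrite /altern subSnn. Qed.

Lemma alternS x y l r : l < r -> altern x y l r.+1 = altern x y l r.-1.
Proof. by move=> h; rewrite /altern (_ : r.+1 - l = (r.-1 - l).+2) /= ?negbK //; lia. Qed.

Lemma flags_letter g v r d : 0 < d -> flags g v false r d -> g (r + d).-1 = v (r + d).-1.-1.
Proof.
case: d => // d _; rewrite flagsS addnS /= /flag => /andP[_ /and3P[_ _ /eqP ->]].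
by [].
Qed.

Lemma edge_optP l i c : l < n -> i < k ->
  (forall j, l < j <= n -> suffix_opt j (C j)) -> C n = 0 ->
  (forall j i', l < j < n -> i' < k -> edge_opt j i' (R j i')) ->
  is_min (edge_cand l i n) c -> edge_opt l i c.
Proof.
move=> hl hi hC hCn hR [hc hmin].
set x := s i l.+1; set y := s i l; set a := altern x y l.
have split_at v r : l < r < n -> (forall j, l <= j <= r -> v j = a j) ->
    total_cost v xpred0 l.+1 (n - l.+1) = run_cost l i r +
      total_cost v (fun i => flags (s i) v false l.+1 (r - l)) r.+1 (n - r.+1).
  move=> hr hv; rewrite (_ : n - l.+1 = (r - l) + (n - r.+1)); last lia.
  rewrite total_add (_ : l.+1 + (r - l) = r.+1); last lia.
  by congr (_ + _); apply: total_ext => j hj; apply: hv; lia.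
(* An input just swapped at [r] carries [v r.-1] there, while a swap across the next edge needs
   [v r.+1]. Once these differ, the pending flags are harmless. *)
have fresh_after v r : l < r < n -> (forall j, l <= j <= r -> v j = a j) ->
    v r.+1 != v r.-1 ->
    total_cost v (fun i => flags (s i) v false l.+1 (r - l)) r.+1 (n - r.+1) =
    total_cost v xpred0 r.+1 (n - r.+1).
  move=> hr hv hne; apply: eq_bigr => i' _; apply: scan_flag => hf.
  have := flags_letter _ hf; rewrite (_ : (l.+1 + (r - l)).-1 = r) => [|]; last lia.
  move=> h /=; apply/negP => /andP[/eqP h1 _]; move: hne; rewrite -h1 h ?eqxx //; lia.
split.
  move=> v hv0 hv1.
  (* [r] is the end of the alternation known so far; it advances until [v] breaks the pattern or the
     string ends. *)
  suff H : forall m r, n - r < m -> l < r <= n -> (forall j, l <= j <= r -> v j = a j) ->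
      c <= total_cost v xpred0 l.+1 (n - l.+1).
    apply: (H n.+1 l.+1); [lia | lia |] => j hj.
    have [->|->] : j = l \/ j = l.+1 by lia.
      by rewrite /a altern0.
    by rewrite /a altern1.
  elim=> // m IH r hm hr hv.
  have [hrn|hrn] : r = n \/ r < n by lia.
    have [hln|hln] : l.+1 = n \/ l.+1 < n by lia.
      by apply: leq_trans (hmin (C n) _) _; [left; rewrite hln | rewrite hCn].
    rewrite (split_at v n.-1); try lia; last by move=> j hj; apply: hv; lia.
    apply: leq_trans (leq_addr _ _).
    rewrite -[leqRHS]addn0 -hCn; apply: hmin; right; exists n.-1; first lia.
    by left; rewrite (_ : n.-1.+1 = n) //; lia.
  have hlr : l < r < n by lia.
  have [hr1|hr1] : r.+1 = n \/ r.+1 < n by lia.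
    rewrite (split_at v r) //; apply: leq_trans (leq_addr _ _).
    rewrite -[leqRHS]addn0 -hCn; apply: hmin; right; exists r; first lia.
    by left; rewrite hr1.
  case: (eqVneq (v r.+1) (v r.-1)) => [heq|hne].
    apply: (IH r.+1); [lia | lia |] => j hj.
    have [hj'|->] : j <= r \/ j = r.+1 by lia.
      by apply: hv; lia.
    by rewrite heq hv ?/a ?alternS //; lia.
  rewrite (split_at v r) // fresh_after //.
  have [->|[i2 hi2 [h1 h2]]] := total_fresh_cases v r (n - r.+1).
    have [|h _] := hC r.+1; first lia.
    apply: leq_trans (hmin (run_cost l i r + C r.+1) _) _; last by rewrite leq_add2l.
    by right; exists r => //; left.
  have [h _] := hR r i2 hlr hi2.
  apply: leq_trans (hmin (run_cost l i r + R r i2) _) _; last by rewrite leq_add2l; apply: h.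
  right; exists r => //; right; exists i2 => //; split=> //.
    by rewrite -h1 hv //; lia.
  by rewrite -h2 -/x -/y -/a -hv //; lia.
have ha : letters a by move=> j; rewrite /a /altern; case: odd; apply: s_lt.
have glue r w : l < r < n -> letters w -> exists v, [/\ letters v,
    forall j, l <= j <= r -> v j = a j & forall j, r < j -> v j = w j].
  move=> hr hw; exists (fun j => if j <= r then a j else w j); split.
  - by move=> j; case: ifP.
  - by move=> j /andP[_ ->].
  - by move=> j hj; rewrite leqNgt hj.
case: hc => [->|[r hr [->|[i2 hi2 [h1 h2 ->]]]]].
- have [|_ [w [hw hCw]]] := hC l.+1; first lia.
  exists (fun j => if j == l then x else w j); split; last 1 first.
  + left; rewrite (@total_blocked_ext _ w) // => j hj; case: ifP => [/eqP|] //; lia.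
  + by move=> j /=; case: ifP => _; [apply: s_lt | apply: hw].
  + by rewrite eqxx.
- have [|_ [w [hw hCw]]] := hC r.+1; first lia.
  have [v [hv hva hvw]] := glue r w hr hw.
  exists v; split=> //; first by rewrite hva ?/a ?altern0 //; lia.
  right; split; first by rewrite hva ?/a ?altern1 //; lia.
  rewrite (split_at v r) // leq_add2l.
  apply: leq_trans (total_le_blocked _ _ _ _) _; apply: leq_trans hCw.
  by rewrite (@total_blocked_ext _ w) // => j hj; apply: hvw; lia.
have [_ [w [hw hwr hor]]] := hR r i2 hr hi2.
have [v [hv hva hvw]] := glue r w hr hw.
(* The run and the witness of the next edge overlap at [r], where both prescribe [s i2 r.+1]. *)
have hvw' j : r <= j -> v j = w j.
  rewrite leq_eqVlt => /orP[/eqP <-|/hvw //].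
  by rewrite hva ?hwr ?h1 //; lia.
exists v; split=> //; first by rewrite hva ?/a ?altern0 //; lia.
right; split; first by rewrite hva ?/a ?altern1 //; lia.
rewrite (split_at v r) // leq_add2l.
(* A blocked witness bounds the cost for any pending flags; in the other case the inequality in
   [edge_leave] makes those flags harmless. *)
case: hor => [h|[hw1 h]].
  apply: leq_trans (total_le_blocked _ _ _ _) _; apply: leq_trans h.
  by rewrite (@total_blocked_ext _ w) // => j hj; apply: hvw; lia.
rewrite fresh_after //; last by rewrite hvw // hw1 (hva r.-1) //; lia.
by apply: leq_trans h; rewrite (@total_ext _ w) // => j hj; apply: hvw'; lia.
Qed.

End DynamicProgram.

(** * Structured programs for the machine *)

Inductive com :=
| Prim of instr
| Seq of com & com
| If of nat & com & com
| While of nat & com.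

Definition is_prim i :=
  match i with IJz _ _ | IJmp _ | IHalt => false | _ => true end.

Definition prim_step i (m : memory) : memory :=
  match i with
  | IConst d v => upd m d v
  | IAdd d a b => upd m d (m a + m b)
  | ISub d a b => upd m d (m a - m b)
  | ILoad d a => upd m d (m (m a))
  | IStore a s => upd m (m a) (m s)
  | _ => m
  end.

Fixpoint com_size c :=
  match c with
  | Prim _ => 1
  | Seq c1 c2 => com_size c1 + com_size c2
  | If _ c1 c2 => (com_size c1 + com_size c2).+2
  | While _ c1 => (com_size c1).+2
  end.

Fixpoint compile b c : seq instr :=
  match c with
  | Prim i => [:: i]
  | Seq c1 c2 => compile b c1 ++ compile (b + com_size c1) c2
  | If r c1 c2 =>
      IJz r (b + (com_size c1).+2) :: compile b.+1 c1 ++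
      IJmp (b + (com_size c1 + com_size c2).+2) :: compile (b + (com_size c1).+2) c2
  | While r c1 =>
      IJz r (b + (com_size c1).+2) :: compile b.+1 c1 ++ [:: IJmp b]
  end.

Lemma size_compile b c : size (compile b c) = com_size c.
Proof.
elim: c b => [i|c1 IH1 c2 IH2|r c1 IH1 c2 IH2|r c1 IH1] b //=;
  rewrite size_cat /= ?IH1 ?IH2 ?addnS ?addn0 //.
Qed.

(** The number is the exact count of machine steps, including tests and jumps. *)
Inductive exec : com -> memory -> nat -> memory -> Prop :=
| ExPrim i m : is_prim i -> exec (Prim i) m 1 (prim_step i m)
| ExSeq c1 c2 m t1 m1 t2 m2 :
    exec c1 m t1 m1 -> exec c2 m1 t2 m2 -> exec (Seq c1 c2) m (t1 + t2) m2
| ExIfT r c1 c2 m t m1 :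
    m r != 0 -> exec c1 m t m1 -> exec (If r c1 c2) m t.+2 m1
| ExIfF r c1 c2 m t m1 :
    m r == 0 -> exec c2 m t m1 -> exec (If r c1 c2) m t.+1 m1
| ExWhileF r c m : m r == 0 -> exec (While r c) m 1 m
| ExWhileT r c m t1 m1 t2 m2 :
    m r != 0 -> exec c m t1 m1 -> exec (While r c) m1 t2 m2 ->
    exec (While r c) m (t1 + t2).+2 m2.

Definition code_at (p : seq instr) b q :=
  forall j, j < size q -> nth IHalt p (b + j) = nth IHalt q j.

Lemma code_at_cat p b q1 q2 :
  code_at p b (q1 ++ q2) -> code_at p b q1 /\ code_at p (b + size q1) q2.
Proof.
move=> h; split=> j hj.
  by rewrite h ?size_cat ?nth_cat ?hj //; lia.
rewrite -addnA h ?size_cat ?nth_cat; last lia.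
by rewrite ltnNge leq_addr addKn.
Qed.

Lemma code_at_cons p b i q :
  code_at p b (i :: q) -> nth IHalt p b = i /\ code_at p b.+1 q.
Proof.
move=> h; split; first by have := h 0 isT; rewrite addn0.
by move=> j hj; have := h j.+1 hj; rewrite addSnnS.
Qed.

Local Arguments run : simpl never.

Lemma run_add p t1 t2 c : run p (t1 + t2) c = run p t2 (run p t1 c).
Proof. by rewrite /run addnC iterD. Qed.

Lemma runS p t c : run p t.+1 c = run p t (step p c).
Proof. by rewrite /run iterSr. Qed.

Lemma exec_run c m t m' : exec c m t m' -> forall p b,
  code_at p b (compile b c) -> run p t (b, m) = (b + com_size c, m').
Proof.
elim=> {c m t m'}.
- move=> i m hi p b /code_at_cons[hp _]; rewrite addn1 /run /= /step hp.
  by case: i hi hp.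
- move=> c1 c2 m t1 m1 t2 m2 _ IH1 _ IH2 p b /= /code_at_cat[h1 h2].
  rewrite run_add (IH1 p b) // IH2 ?addnA //.
  by rewrite size_compile in h2.
- move=> r c1 c2 m t m1 hr _ IH p b /= /code_at_cons[h0 /code_at_cat[h1]].
  rewrite size_compile => /code_at_cons[h2 _].
  rewrite runS /step h0 (negbTE hr) -addn1 run_add (IH p b.+1) //.
  by rewrite /run /= /step h2.
- move=> r c1 c2 m t m1 hr _ IH p b /= /code_at_cons[h0 /code_at_cat[h1]].
  rewrite size_compile => /code_at_cons[h2 h3].
  rewrite runS /step h0 hr (IH p) -?addnA ?addSn //.
  by move: h3; rewrite addSn addnS addnS.
- by move=> r c m hr p b /= /code_at_cons[h0 _]; rewrite /run /= /step h0 hr.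
- move=> r c m t1 m1 t2 m2 hr _ IH1 _ IH2 p b hp.
  have := hp => /= /code_at_cons[h0 /code_at_cat[h1]].
  rewrite size_compile => /code_at_cons[h2 _].
  rewrite runS /step h0 (negbTE hr) -addnS run_add (IH1 p b.+1) //.
  by rewrite runS /step h2 IH2.
Qed.

(** * Time-bounded total correctness *)

Definition ok c m T (Q : memory -> Prop) :=
  exists t m', [/\ exec c m t m', t <= T & Q m'].

Lemma ok_prim i m (Q : memory -> Prop) : is_prim i -> Q (prim_step i m) -> ok (Prim i) m 1 Q.
Proof. by move=> hi hQ; exists 1, (prim_step i m); split=> //; apply: ExPrim. Qed.

Lemma ok_seq c1 c2 m T1 T2 Q P : ok c1 m T1 P -> (forall m1, P m1 -> ok c2 m1 T2 Q) ->
  ok (Seq c1 c2) m (T1 + T2) Q.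
Proof.
move=> [t1 [m1 [h1 ht1 /[swap] h hP]]]; have [t2 [m2 [h2 ht2 hQ]]] := h _ hP.
by exists (t1 + t2), m2; split=> //; [apply: ExSeq h1 h2 | apply: leq_add].
Qed.

Lemma ok_seq_prim i c2 m T Q : is_prim i -> ok c2 (prim_step i m) T Q ->
  ok (Seq (Prim i) c2) m T.+1 Q.
Proof.
move=> hi [t [m' [h ht hQ]]]; exists t.+1, m'; split=> //.
by rewrite -add1n; apply: ExSeq h; apply: ExPrim.
Qed.

Lemma ok_weaken c m T T' (P Q : memory -> Prop) :
  ok c m T P -> T <= T' -> (forall m', P m' -> Q m') -> ok c m T' Q.
Proof.
move=> [t [m' [h ht hP]]] hT hPQ; exists t, m'; split=> //; last exact: hPQ.
exact: leq_trans ht hT.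
Qed.

Lemma ok_if r c1 c2 m T Q :
  (m r != 0 -> ok c1 m T Q) -> (m r == 0 -> ok c2 m T Q) -> ok (If r c1 c2) m T.+2 Q.
Proof.
case: (boolP (m r == 0)) => hr h1 h2.
  have [t [m' [h ht hQ]]] := h2 isT; exists t.+1, m'; split=> //; last by lia.
  exact: ExIfF.
have [t [m' [h ht hQ]]] := h1 isT; exists t.+2, m'; split=> //.
exact: ExIfT.
Qed.

(** The variant may drop by more than one in a round, as happens when binary digits are stripped. A
    round costs [T] plus the test and the jump back; the final unit is the failing test. *)
Lemma ok_while_le (I : nat -> memory -> Prop) r c T j m :
  I j m -> (forall j m, I j m -> (m r == 0) = (j == 0)) ->
  (forall j m, I j.+1 m -> ok c m T (fun m' => exists2 j', j' <= j & I j' m')) ->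
  ok (While r c) m (j * T.+2).+1 (I 0).
Proof.
move=> + h0 hS; have [b] := ubnP j; elim: b j m => // b IH [|j] m hj hI.
  by exists 1, m; split=> //; apply: ExWhileF; rewrite (h0 _ _ hI).
have [t1 [m1 [h1 ht1 [j' hj' hI1]]]] := hS _ _ hI.
have [|t2 [m2 [h2 ht2 hI2]]] := IH _ _ _ hI1; first by lia.
exists (t1 + t2).+2, m2; split=> //; last by nia.
by apply: ExWhileT h1 h2; rewrite (h0 _ _ hI).
Qed.

Lemma ok_while (I : nat -> memory -> Prop) r c T j m :
  I j m -> (forall j m, I j m -> (m r == 0) = (j == 0)) ->
  (forall j m, I j.+1 m -> ok c m T (I j)) ->
  ok (While r c) m (j * T.+2).+1 (I 0).
Proof.
move=> hI h0 hS; apply: ok_while_le hI h0 _ => j' m' hI'.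
by apply: ok_weaken (hS _ _ hI') _ _ => // m'' h; exists j'.
Qed.

(** * A loop language with arrays *)

Record state := State { reg : nat -> nat; arr : nat -> nat -> nat }.

Definition set_reg r x st := State (upd (reg st) r x) (arr st).
Definition set_arr a i x st :=
  State (reg st) (fun a' i' => if (a' == a) && (i' == i) then x else arr st a' i').

Inductive expr :=
| ECst of nat | EVar of nat | EAdd of expr & expr | ESub of expr & expr | EGet of nat & expr.

Inductive cmd :=
| Skip
| Assign of nat & expr
| Put of nat & expr & expr
| Then of cmd & cmd
| Cond of expr & cmd & cmd
| For of nat & nat & cmd.

Fixpoint eval st e :=
  match e with
  | ECst x => x
  | EVar v => reg st v
  | EAdd e1 e2 => eval st e1 + eval st e2
  | ESub e1 e2 => eval st e1 - eval st e2
  | EGet a e1 => arr st a (eval st e1)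
  end.

Fixpoint sem c st :=
  match c with
  | Skip => st
  | Assign v e => set_reg v (eval st e) st
  | Put a e1 e2 => set_arr a (eval st e1) (eval st e2) st
  | Then c1 c2 => sem c2 (sem c1 st)
  | Cond e c1 c2 => if eval st e != 0 then sem c1 st else sem c2 st
  | For r b c1 =>
      set_reg r (reg st b) (iteri (reg st b) (fun j st' => sem c1 (set_reg r j st')) st)
  end.

Fixpoint regs_written c : seq nat :=
  match c with
  | Assign v _ => [:: v]
  | Then c1 c2 | Cond _ c1 c2 => regs_written c1 ++ regs_written c2
  | For r _ c1 => r :: regs_written c1
  | _ => [::]
  end.

Fixpoint arrs_written c : seq nat :=
  match c with
  | Put a _ _ => [:: a]
  | Then c1 c2 | Cond _ c1 c2 => arrs_written c1 ++ arrs_written c2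
  | For _ _ c1 => arrs_written c1
  | _ => [::]
  end.

Lemma sem_reg_frame c st v : v \notin regs_written c -> reg (sem c st) v = reg st v.
Proof.
elim: c st => [|r e|a e1 e2|c1 IH1 c2 IH2|e c1 IH1 c2 IH2|r b c1 IH1] st //=.
- by rewrite inE /upd => /negbTE ->.
- by rewrite mem_cat negb_or => /andP[h1 h2]; rewrite IH2 // IH1.
- by rewrite mem_cat negb_or => /andP[h1 h2]; case: ifP => _; rewrite ?IH1 ?IH2.
rewrite inE negb_or => /andP[/negbTE h1 h2]; rewrite /upd h1.
by elim: (reg st b) => //= j IH; rewrite IH1 //= /upd h1.
Qed.

Lemma sem_arr_frame c st a : a \notin arrs_written c -> arr (sem c st) a = arr st a.
Proof.
elim: c st => [|r e|a' e1 e2|c1 IH1 c2 IH2|e c1 IH1 c2 IH2|r b c1 IH1] st //=.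
- by rewrite inE => /negbTE ->.
- by rewrite mem_cat negb_or => /andP[h1 h2]; rewrite IH2 // IH1.
- by rewrite mem_cat negb_or => /andP[h1 h2]; case: ifP => _; rewrite ?IH1 ?IH2.
by move=> h; elim: (reg st b) => //= j IH; rewrite IH1.
Qed.

Lemma sem_for (I : nat -> state -> Prop) r b c st : I 0 st ->
  (forall j st', j < reg st b -> I j st' -> I j.+1 (sem c (set_reg r j st'))) ->
  exists2 st', I (reg st b) st' & sem (For r b c) st = set_reg r (reg st b) st'.
Proof.
move=> h0 hS /=; eexists; last reflexivity.
have: reg st b <= reg st b by []; elim: {1 3 4}(reg st b) => //= j IH hj.
by apply: hS; [lia | apply: IH; lia].
Qed.

Local Notation num_vars := 20 (only parsing).
Local Notation num_temps := 12 (only parsing).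
Local Notation num_regs := 36 (only parsing).
Definition var_addr v := 4 + v.
Definition tmp_addr d := 4 + num_vars + d.

(* Cell 1 holds the heap base and cell 3 holds zero; entry [i] of array [a] lives at base + 8 i + a. *)
Definition array_addr d a :=
  Seq (Prim (IAdd (tmp_addr d) (tmp_addr d) (tmp_addr d)))
 (Seq (Prim (IAdd (tmp_addr d) (tmp_addr d) (tmp_addr d)))
 (Seq (Prim (IAdd (tmp_addr d) (tmp_addr d) (tmp_addr d)))
 (Seq (Prim (IAdd (tmp_addr d) (tmp_addr d) 1))
 (Seq (Prim (IConst (tmp_addr d.+1) a))
      (Prim (IAdd (tmp_addr d) (tmp_addr d) (tmp_addr d.+1))))))).

Fixpoint cexpr d e : com :=
  match e with
  | ECst x => Prim (IConst (tmp_addr d) x)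
  | EVar v => Prim (IAdd (tmp_addr d) (var_addr v) 3)
  | EAdd e1 e2 => Seq (cexpr d e1) (Seq (cexpr d.+1 e2)
      (Prim (IAdd (tmp_addr d) (tmp_addr d) (tmp_addr d.+1))))
  | ESub e1 e2 => Seq (cexpr d e1) (Seq (cexpr d.+1 e2)
      (Prim (ISub (tmp_addr d) (tmp_addr d) (tmp_addr d.+1))))
  | EGet a e1 => Seq (cexpr d e1) (Seq (array_addr d a)
      (Prim (ILoad (tmp_addr d) (tmp_addr d))))
  end.

Definition for_test r b := Prim (ISub (tmp_addr 0) (var_addr b) (var_addr r)).

Fixpoint ccmd c : com :=
  match c with
  | Skip => Prim (IConst (tmp_addr 0) 0)
  | Assign v e => Seq (cexpr 0 e) (Prim (IAdd (var_addr v) (tmp_addr 0) 3))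
  | Put a e1 e2 => Seq (cexpr 0 e1) (Seq (array_addr 0 a) (Seq (cexpr 1 e2)
      (Prim (IStore (tmp_addr 0) (tmp_addr 1)))))
  | Then c1 c2 => Seq (ccmd c1) (ccmd c2)
  | Cond e c1 c2 => Seq (cexpr 0 e) (If (tmp_addr 0) (ccmd c1) (ccmd c2))
  | For r b c1 =>
      Seq (Prim (IConst (var_addr r) 0)) (Seq (for_test r b)
      (While (tmp_addr 0) (Seq (ccmd c1)
        (Seq (Prim (IConst (tmp_addr 0) 1))
        (Seq (Prim (IAdd (var_addr r) (var_addr r) (tmp_addr 0))) (for_test r b))))))
  end.

Fixpoint ecost e :=
  match e with
  | ECst _ | EVar _ => 1
  | EAdd e1 e2 | ESub e1 e2 => ecost e1 + (ecost e2 + 1)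
  | EGet _ e1 => ecost e1 + 7
  end.

(** Well-formed loops are bounded by variable 0 or 1, so the time is a polynomial in their values,
    known before the run. *)
Fixpoint ccost (k n : nat) c :=
  match c with
  | Skip => 1
  | Assign _ e => ecost e + 1
  | Put _ e1 e2 => ecost e1 + (6 + (ecost e2 + 1))
  | Then c1 c2 => ccost k n c1 + ccost k n c2
  | Cond e c1 c2 => ecost e + (ccost k n c1 + ccost k n c2).+2
  | For _ b c1 => 2 + ((if b == 0 then k else n) * (ccost k n c1 + 3).+2).+1
  end.

(** Temporary [d] receives the value and the higher ones are scratch; an array access takes [d.+1]
    for the array number. *)
Fixpoint ewf d e :=
  match e with
  | ECst _ => d < num_temps
  | EVar v => (v < num_vars) && (d < num_temps)
  | EAdd e1 e2 | ESub e1 e2 => ewf d e1 && ewf d.+1 e2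
  | EGet a e1 => [&& a < 8, d.+1 < num_temps & ewf d e1]
  end.

(* Variables 0 and 1 hold the two loop bounds and are never assigned. *)
Fixpoint cwf c :=
  match c with
  | Skip => true
  | Assign v e => [&& 1 < v, v < num_vars & ewf 0 e]
  | Put a e1 e2 => [&& a < 8, ewf 0 e1 & ewf 1 e2]
  | Then c1 c2 => cwf c1 && cwf c2
  | Cond e c1 c2 => [&& ewf 0 e, cwf c1 & cwf c2]
  | For r b c1 => [&& 1 < r, r < num_vars, b < 2, r \notin regs_written c1 & cwf c1]
  end.

(** Arrays are unbounded and together cover all cells from [B] on, so a state can be read off any
    memory whose cells 1 and 3 are right. *)
Definition represents B st (m : memory) :=
  [/\ m 1 = B, m 3 = 0, forall v, v < num_vars -> m (var_addr v) = reg st v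
    & forall a i, a < 8 -> m (B + 8 * i + a) = arr st a i].

Lemma upd_eq m a x : upd m a x a = x.
Proof. by rewrite /upd eqxx. Qed.

Lemma upd_neq m a x b : b != a -> upd m a x b = m b.
Proof. by rewrite /upd => /negbTE ->. Qed.

(** * Correctness and cost of compiled programs *)

Section Simulation.
Variable B : nat.
Hypothesis B_ge : num_regs <= B.

Lemma rel_tmp st m d x : d < num_temps -> represents B st m -> represents B st (upd m (tmp_addr d) x).
Proof.
move=> hd [h1 h2 h3 h4].
split=> [||v hv|a i ha]; rewrite upd_neq ?h1 ?h2 ?h3 ?h4 // /tmp_addr ?/var_addr; lia.
Qed.

Lemma rel_var st m v x : v < num_vars -> represents B st m ->
  represents B (set_reg v x st) (upd m (var_addr v) x).
Proof.
move=> hv [h1 h2 h3 h4].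
split=> [||w hw|a i ha]; try (rewrite upd_neq ?h1 ?h2 ?h4 // /var_addr; lia).
rewrite /upd (_ : (var_addr w == var_addr v) = (w == v)) /=; last by rewrite /var_addr; lia.
by rewrite h3 // /upd.
Qed.

Lemma rel_arr st m a i x : a < 8 -> represents B st m ->
  represents B (set_arr a i x st) (upd m (B + 8 * i + a) x).
Proof.
move=> hd [h1 h2 h3 h4].
split=> [||w hw|a' i' ha']; try (rewrite upd_neq ?h1 ?h2 ?h3 // ?/var_addr; lia).
rewrite /upd /=; have -> : (B + 8 * i' + a' == B + 8 * i + a) = (a' == a) && (i' == i) by lia.
by case: ifP => // _; apply: h4.
Qed.

(** Stack discipline of the temporaries: a left operand survives the evaluation of the right one. *)
Definition keeps d (m m' : memory) := forall j, j < d -> m' (tmp_addr j) = m (tmp_addr j).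

Lemma ok_array_addr st d a m : d.+1 < num_temps -> represents B st m ->
  ok (array_addr d a) m 6 (fun m' => [/\ represents B st m', keeps d m m' &
     m' (tmp_addr d) = B + 8 * m (tmp_addr d) + a]).
Proof.
move=> hd hm; have hB : m 1 = B by case: hm.
do 5! [apply: ok_seq_prim => //]; apply: ok_prim => //; split.
- by do 6! [apply: rel_tmp; first by lia].
- move=> j hj; have hne d' : d <= d' -> tmp_addr j != tmp_addr d' by rewrite /tmp_addr; lia.
  by rewrite /= !upd_neq // hne.
have hne : (1 != tmp_addr d) /\ tmp_addr d != tmp_addr d.+1 by rewrite /tmp_addr; lia.
rewrite /= !(upd_eq, upd_neq) ?hB; try by case: hne.
lia.
Qed.


Lemma keeps_trans d m1 m2 m3 : keeps d m1 m2 -> keeps d m2 m3 -> keeps d m1 m3.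
Proof. by move=> h1 h2 j hj; rewrite h2 // h1. Qed.

Lemma keeps_upd d m m' x : keeps d m m' -> keeps d m (upd m' (tmp_addr d) x).
Proof.
by move=> h j hj; rewrite upd_neq ?h // /tmp_addr; lia.
Qed.

Lemma keepsW d d' m m' : d <= d' -> keeps d' m m' -> keeps d m m'.
Proof. by move=> hd h j hj; apply: h; lia. Qed.

Lemma ewf_lt d e : ewf d e -> d < num_temps.
Proof.
elim: e d => [x|v|e1 IH1 e2 IH2|e1 IH1 e2 IH2|a e IH] d //=.
- by case/andP.
- by case/andP => /IH1.
- by case/andP => /IH1.
- by case/and3P => _ _ /IH.
Qed.

Lemma ok_cexpr st d e m : ewf d e -> represents B st m ->
  ok (cexpr d e) m (ecost e) (fun m' => [/\ represents B st m', keeps d m m' &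
     m' (tmp_addr d) = eval st e]).
Proof.
have hbin (i : nat -> nat -> nat -> instr) (f : nat -> nat -> nat) :
    (forall d a b, is_prim (i d a b)) ->
    (forall d a b m, prim_step (i d a b) m = upd m d (f (m a) (m b))) ->
    forall e1 e2, 
    (forall d m, ewf d e1 -> represents B st m -> ok (cexpr d e1) m (ecost e1)
      (fun m' => [/\ represents B st m', keeps d m m' & m' (tmp_addr d) = eval st e1])) ->
    (forall d m, ewf d e2 -> represents B st m -> ok (cexpr d e2) m (ecost e2)
      (fun m' => [/\ represents B st m', keeps d m m' & m' (tmp_addr d) = eval st e2])) ->
    forall d m, ewf d e1 -> ewf d.+1 e2 -> represents B st m ->
    ok (Seq (cexpr d e1) (Seq (cexpr d.+1 e2)
         (Prim (i (tmp_addr d) (tmp_addr d) (tmp_addr d.+1)))))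
       m (ecost e1 + (ecost e2 + 1))
      (fun m' => [/\ represents B st m', keeps d m m' &
         m' (tmp_addr d) = f (eval st e1) (eval st e2)]).
  move=> hi hs e1 e2 IH1 IH2 {}d {}m w1 w2 hm.
  apply: ok_seq (IH1 _ _ w1 hm) _ => m1 [r1 k1 v1].
  apply: ok_seq (IH2 _ _ w2 r1) _ => m2 [r2 k2 v2].
  apply: ok_prim; rewrite ?hs //; split.
  - by apply: rel_tmp => //; apply: ewf_lt w1.
  - by apply: keeps_upd; apply: keeps_trans k1 _; apply: keepsW k2.
  by rewrite upd_eq v2 k2 // v1.
elim: e d m => [x|v|e1 IH1 e2 IH2|e1 IH1 e2 IH2|a e IH] d m /=.
- move=> hd hm; apply: ok_prim => //=; split; rewrite ?upd_eq //.
    exact: rel_tmp.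
  exact: keeps_upd.
- case/andP=> hv hd hm; apply: ok_prim => //=; split; rewrite ?upd_eq //.
  + exact: rel_tmp.
  + exact: keeps_upd.
  by case: hm => _ -> -> //; rewrite addn0.
- by case/andP; apply: (hbin IAdd addn).
- by case/andP; apply: (hbin ISub subn).
case/and3P=> ha hd we hm.
apply: ok_seq (IH _ _ we hm) _ => m1 [r1 k1 v1].
apply: (ok_seq (T1 := 6) (T2 := 1)) (ok_array_addr _ hd r1) _ => m2 [r2 k2 v2].
apply: ok_prim => //=; split.
- by apply: rel_tmp => //; lia.
- by apply: keeps_upd; apply: keeps_trans k1 k2.
by rewrite upd_eq v2 v1; case: r2 => _ _ _ ->.
Qed.

Lemma cwf_written c v : cwf c -> v < 2 -> v \notin regs_written c.
Proof.
move=> + hv; elim: c => [|r e|a e1 e2|c1 IH1 c2 IH2|e c1 IH1 c2 IH2|r b c1 IH1] //=.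
- by case/and3P=> hr _ _; rewrite inE; lia.
- by case/andP=> /IH1 h1 /IH2 h2; rewrite mem_cat negb_or h1.
- by case/and3P=> _ /IH1 h1 /IH2 h2; rewrite mem_cat negb_or h1.
by case/and5P=> hr _ _ _ /IH1 h1; rewrite inE negb_or h1 andbT; lia.
Qed.

Lemma ok_ccmd c st m : cwf c -> represents B st m ->
  ok (ccmd c) m (ccost (reg st 0) (reg st 1) c) (represents B (sem c st)).
Proof.
elim: c st m => [|v e|a e1 e2|c1 IH1 c2 IH2|e c1 IH1 c2 IH2|r b c1 IH1] st m.
- by move=> _ hm; apply: ok_prim => //=; apply: rel_tmp.
- case/and3P=> _ hv we hm; apply: ok_seq (ok_cexpr we hm) _ => m1 [r1 _ v1].
  apply: ok_prim => //=; rewrite v1.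
  by have [_ -> _ _] := r1; rewrite addn0; apply: rel_var.
- case/and3P=> ha w1 w2 hm.
  apply: ok_seq (ok_cexpr w1 hm) _ => m1 [r1 _ v1].
  apply: ok_seq (ok_array_addr a (isT : 1 < num_temps) r1) _ => m2 [r2 _ v2].
  apply: ok_seq (ok_cexpr w2 r2) _ => m3 [r3 k3 v3].
  by apply: ok_prim => //=; rewrite v3 k3 // v2 v1; apply: rel_arr.
- case/andP=> w1 w2 hm; apply: ok_seq (IH1 _ _ w1 hm) _ => m1 r1 /=.
  have := IH2 _ _ w2 r1.
  by rewrite !(sem_reg_frame _ (cwf_written w1 _)).
- case/and3P=> we w1 w2 hm; apply: ok_seq (ok_cexpr we hm) _ => m1 [r1 _ v1].
  have semE : sem (Cond e c1 c2) st = if eval st e != 0 then sem c1 st else sem c2 st by [].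
  apply: ok_if; rewrite v1 semE => h.
    by rewrite h; apply: ok_weaken (IH1 _ _ w1 r1) (leq_addr _ _) _.
  by rewrite h; apply: ok_weaken (IH2 _ _ w2 r1) (leq_addl _ _) _.
case/and5P=> hr1 hr hb hrw w1 hm.
set n := reg st b; set body := fun j st' => sem c1 (set_reg r j st').
have bodyE v j : v < 2 -> reg (iteri j body st) v = reg st v.
  move=> hv; elim: j => //= j IHj; rewrite /body sem_reg_frame ?cwf_written //=.
  by rewrite upd_neq //; lia.
have br : b != r by lia.
(* [j] is the number of remaining rounds, which [for_test] leaves in temporary 0; the counter stands
   at [n - j]. *)
pose I j m' := [/\ represents B (set_reg r (n - j) (iteri (n - j) body st)) m',
   m' (tmp_addr 0) = j & j <= n].
have test_ok j m' : j <= n -> represents B (set_reg r (n - j) (iteri (n - j) body st)) m' ->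
    ok (for_test r b) m' 1 (I j).
  move=> hj r'; apply: ok_prim => //=; split=> //; first exact: rel_tmp.
  case: r' => _ _ hv _; rewrite upd_eq !hv //=; last by lia.
  rewrite upd_neq // upd_eq bodyE // -/n; lia.
rewrite /= -/n -/body (_ : 2 + _ =
  1 + (1 + (n * (ccost (reg st 0) (reg st 1) c1 + 3).+2).+1)); last first.
  rewrite addnA; congr (2 + (_ * _).+1); rewrite /n.
  by case: (b) hb => [|[]].
apply: (ok_seq (P := represents B (set_reg r 0 st))).
  by apply: ok_prim => //=; apply: rel_var.
move=> m1 r1; apply: ok_seq (test_ok n m1 _ _) _ => //; first by rewrite subnn.
move=> m2 I2; apply: ok_weaken (ok_while (I := I) I2 _ _) _ _ => //.
- by move=> j m' [_ -> _].
- move=> j m' [r' _ hj].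
  have := IH1 _ _ w1 r'.
  rewrite /= !upd_neq ?bodyE //; try lia.
  move=> h; apply: ok_seq h _ => m3 r3.
  do 2! apply: ok_seq_prim => //; apply: test_ok; first by lia.
  have hne : var_addr r != tmp_addr 0 by rewrite /var_addr /tmp_addr; lia.
  rewrite /= upd_eq (upd_neq _ _ hne).
  have r4 := rel_tmp 1 (isT : 0 < num_temps) r3.
  have [_ _ hv _] := r3; rewrite hv // sem_reg_frame //= upd_eq addn1.
  have -> : n - j = (n - j.+1).+1 by lia.
  exact: rel_var.
by move=> m' [] ; rewrite subn0.
Qed.

End Simulation.

(** * The consensus program *)

Local Notation vK := 0 (only parsing).
Local Notation vN := 1 (only parsing).
Local Notation vD := 2 (only parsing).
Local Notation vJ := 3 (only parsing).
Local Notation vL := 4 (only parsing).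
Local Notation vI0 := 5 (only parsing).
Local Notation vX := 6 (only parsing).
Local Notation vY := 7 (only parsing).
Local Notation vR := 8 (only parsing).
Local Notation vAcc := 9 (only parsing).
Local Notation vBest := 10 (only parsing).
Local Notation vI := 11 (only parsing).
Local Notation vTmp := 12 (only parsing).
Local Notation vRes := 13 (only parsing).

Local Notation aIn := 0 (only parsing).
Local Notation aRow := 1 (only parsing).
Local Notation aC := 2 (only parsing).
Local Notation aR := 3 (only parsing).
Local Notation aUsed := 4 (only parsing).

(** There is no multiplication: the row offsets [i * n] are tabulated once, by repeated addition. *)
Definition letter i j := EGet aIn (EAdd (EGet aRow i) j).
Definition edge_entry i l := EGet aR (EAdd (EGet aRow i) l).
(** Subtraction is truncated, so one of the two terms is always zero; for the same reason
    [a - (a - b)] is a minimum. *)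
Definition neq_expr a b := EAdd (ESub a b) (ESub b a).
Definition min_expr a b := ESub a (ESub a b).

(** One step of [scan] for input [vI], with [vX] and [vY] the candidate letters at [vR - 1] and
    [vR]: [aUsed] keeps the flag, [vAcc] sums the charges. *)
Definition column_step :=
  Cond (neq_expr (letter (EVar vI) (EVar vR)) (EVar vY))
       (Cond (EAdd (EGet aUsed (EVar vI))
               (EAdd (neq_expr (letter (EVar vI) (ESub (EVar vR) (ECst 1))) (EVar vY))
                    (neq_expr (letter (EVar vI) (EVar vR)) (EVar vX))))
          (Then (Assign vAcc (EAdd (EVar vAcc) (ECst 1))) (Put aUsed (EVar vI) (ECst 0)))
          (Put aUsed (EVar vI) (ECst 1)))
       (Put aUsed (EVar vI) (ECst 0)).

Definition column_cmd := For vI vK column_step.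

Definition leave_step :=
  Cond (neq_expr (letter (EVar vI) (EAdd (EVar vR) (ECst 1))) (EVar vY)) Skip
       (Cond (neq_expr (letter (EVar vI) (EVar vR)) (EVar vX))
          (Assign vBest (min_expr (EVar vBest)
             (EAdd (EVar vAcc) (edge_entry (EVar vI) (EVar vR)))))
          Skip).

Definition leave_cmd := For vI vK leave_step.

Definition swap_cmd :=
  Then (Assign vTmp (EVar vX)) (Then (Assign vX (EVar vY)) (Assign vY (EVar vTmp))).

Definition next_suffix e := EGet aC (EAdd e (ECst 1)).

(** Every loop starts at 0, so the rounds with [vR <= vL] are idle; exchanging [vX] and [vY]
    advances the alternation. *)
Definition run_step :=
  Cond (ESub (EVar vR) (EVar vL))
      (Then column_cmd
      (Then (Assign vBest (min_expr (EVar vBest) (EAdd (EVar vAcc) (next_suffix (EVar vR)))))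
      (Then leave_cmd swap_cmd)))
      Skip.

Definition run_cmd := For vR vN run_step.

Definition clear_step := Put aUsed (EVar vI) (ECst 0).

Definition clear_cmd := For vI vK clear_step.

Definition edge_cmd :=
  Then (Assign vX (letter (EVar vI0) (EAdd (EVar vL) (ECst 1))))
 (Then (Assign vY (letter (EVar vI0) (EVar vL)))
 (Then (Assign vAcc (ECst 0))
 (Then (Assign vBest (next_suffix (EVar vL)))
 (Then clear_cmd
 (Then run_cmd
       (Put aR (EAdd (EGet aRow (EVar vI0)) (EVar vL)) (EVar vBest))))))).

Definition edges_cmd := For vI0 vK edge_cmd.

Definition count_step :=
  Cond (neq_expr (letter (EVar vI) (EVar vL)) (EVar vY))
    (Assign vAcc (EAdd (EVar vAcc) (ECst 1))) Skip.

Definition count_cmd := Then (Assign vAcc (ECst 0)) (For vI vK count_step).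

Definition try_letter e rest :=
  Then (Assign vY e)
 (Then count_cmd
       (Assign vBest (min_expr (EVar vBest) (EAdd (EVar vAcc) rest)))).

Definition candidates_step :=
  Then (try_letter (letter (EVar vI0) (EVar vL)) (next_suffix (EVar vL)))
          (try_letter (letter (EVar vI0) (EAdd (EVar vL) (ECst 1)))
                      (edge_entry (EVar vI0) (EVar vL))).

Definition candidates_cmd := For vI0 vK candidates_step.

Definition position_cmd :=
  Then (Assign vL (ESub (ESub (EVar vN) (ECst 1)) (EVar vJ)))
 (Then edges_cmd
 (Then (Assign vBest (EAdd (next_suffix (EVar vL)) (EVar vK)))
 (Then candidates_cmd
       (Put aC (EVar vL) (EVar vBest))))).

Definition rows_step :=
  Then (Put aRow (EVar vI) (EVar vAcc)) (Assign vAcc (EAdd (EVar vAcc) (EVar vN))).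

Definition rows_cmd := Then (Assign vAcc (ECst 0)) (For vI vK rows_step).

Definition consensus_cmd :=
  Then rows_cmd
 (Then (Put aC (EVar vN) (ECst 0))
 (Then (For vJ vN position_cmd)
       (Assign vRes (ESub (ECst 1) (ESub (EGet aC (ECst 0)) (EVar vD)))))).

Lemma cwf_consensus : cwf consensus_cmd.
Proof. by []. Qed.

Lemma ccost_consensus k n : 0 < k -> 0 < n ->
  ccost k n consensus_cmd <= 1000 * (k ^ 2 * n ^ 2).
Proof. by move=> hk hn; rewrite /=; nia. Qed.

Lemma sem_then c1 c2 st : sem (Then c1 c2) st = sem c2 (sem c1 st).
Proof. by []. Qed.

Definition agree (ws was : seq nat) st st' :=
  (forall v, v \notin ws -> reg st' v = reg st v) /\
  (forall a, a \notin was -> arr st' a = arr st a).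

Lemma sem_agree c st : agree (regs_written c) (arrs_written c) st (sem c st).
Proof. by split=> *; [apply: sem_reg_frame | apply: sem_arr_frame]. Qed.

(** The frame is carried along with the invariant, which then needs to mention only what the body
    changes. *)
Lemma sem_for_agree (I : nat -> state -> Prop) r b c st : I 0 st ->
  (forall j st', j < reg st b -> I j st' ->
     agree (r :: regs_written c) (arrs_written c) st st' ->
     I j.+1 (sem c (set_reg r j st'))) ->
  exists2 st', I (reg st b) st' & sem (For r b c) st = set_reg r (reg st b) st'.
Proof.
move=> h0 hS.
have [||st' [h1 _] h2] := @sem_for
  (fun j st' => I j st' /\ agree (r :: regs_written c) (arrs_written c) st st') r b c st; first by [].
  move=> j st' hj [hI ha]; split; first exact: hS.
  have [h1 h2] := sem_agree c (set_reg r j st'); case: ha => h3 h4; split.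
    move=> v; rewrite inE negb_or => /andP[/negbTE hv hv'].
    by rewrite h1 //= /upd hv h3 // inE negb_or hv hv'.
  by move=> a ha; rewrite h2 //= h4.
by exists st'.
Qed.

(** * The program computes the tables of the dynamic program *)

Section Correctness.
Variables (k n sigma : nat) (inp : nat -> nat).
Hypothesis inp_lt : forall x, inp x < sigma.

Definition in_letter i j := inp (i * n + j).

Local Notation s := in_letter.

Definition env st :=
  [/\ reg st vK = k, reg st vN = n, forall x, arr st aIn x = inp x &
      forall i, i < k -> arr st aRow i = i * n].

Lemma env_agree ws was st st' : agree ws was st st' -> 
  [&& vK \notin ws, vN \notin ws, aIn \notin was & aRow \notin was] ->
  env st -> env st'.
Proof.
move=> [h1 h2] /and4P[w0 w1 a0 a1] [e1 e2 e3 e4].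
by split; rewrite ?h1 ?h2.
Qed.

Lemma eval_letter st i j : env st -> eval st i < k ->
  eval st (letter i j) = s (eval st i) (eval st j).
Proof. by move=> [_ _ h3 h4] hi; rewrite /= h3 h4. Qed.

Lemma eval_edge st i l : env st -> eval st i < k ->
  eval st (edge_entry i l) = arr st aR (eval st i * n + eval st l).
Proof. by move=> [_ _ _ h4] hi; rewrite /= h4. Qed.

Lemma eval_neq st a b : (eval st (neq_expr a b) != 0) = (eval st a != eval st b).
Proof. by rewrite /=; lia. Qed.

Lemma eval_or st a b :
  (eval st (EAdd a b) != 0) = (eval st a != 0) || (eval st b != 0).
Proof. by rewrite /=; lia. Qed.

Lemma reg_assign v e st : reg (sem (Assign v e) st) v = eval st e.
Proof. by rewrite /= upd_eq. Qed.

Lemma eval_min st a b : eval st (min_expr a b) = minn (eval st a) (eval st b).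
Proof. by rewrite /=; lia. Qed.

Lemma sem_cond e c1 c2 st :
  sem (Cond e c1 c2) st = if eval st e != 0 then sem c1 st else sem c2 st.
Proof. by []. Qed.

Lemma column_ok st r x y acc (b : nat -> bool) : env st ->
  reg st vR = r -> reg st vX = x -> reg st vY = y -> reg st vAcc = acc ->
  (forall i, i < k -> arr st aUsed i = b i) ->
  let st' := sem column_cmd st in
  (forall i, i < k -> arr st' aUsed i = flag (s i) (b i) r x y) /\
  reg st' vAcc = acc + \sum_(i < k) charge (s i) (b i) r x y.
Proof.
move=> he hr hx hy hacc hb.
have hk : reg st vK = k by case: he.
pose I j st' := [/\ forall i, i < j -> arr st' aUsed i = flag (s i) (b i) r x y,
   forall i, j <= i < k -> arr st' aUsed i = b i &
   reg st' vAcc = acc + \sum_(i < j) charge (s i) (b i) r x y].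
have [||st1 [h1 h2 h3] ->] := @sem_for_agree I vI vK column_step st.
- by split=> //; rewrite big_ord0 addn0.
- move=> j st1; rewrite hk => hj [h1 h2 h3] hag.
  have he1 := env_agree hag isT he; case: hag => hr1 _.
  set st2 := set_reg vI j st1.
  have he2 : env st2 by case: he1 => e1 e2 e3 e4.
  have vj : eval st2 (EVar vI) = j by [].
  have vr : eval st2 (EVar vR) = r by rewrite -hr -hr1.
  have vy : eval st2 (EVar vY) = y by rewrite -hy -hr1.
  have vx : eval st2 (EVar vX) = x by rewrite -hx -hr1.
  have vl e : eval st2 (letter (EVar vI) e) = s j (eval st2 e).
    by rewrite eval_letter.
  have hu : arr st2 aUsed j = b j by rewrite h2 // leqnn.
  rewrite sem_cond eval_neq vl vr vy.
  (* The outcomes of a step differ only in the new flag [v] and the charge [a]. *)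
  have upd_case v a st3 : v = flag (s j) (b j) r x y :> nat ->
     a = charge (s j) (b j) r x y :> nat ->
     (forall i, arr st3 aUsed i = if i == j then v else arr st1 aUsed i) ->
     reg st3 vAcc = reg st1 vAcc + a -> I j.+1 st3.
    move=> hv ha h4 h5; split.
    + move=> i; rewrite ltnS leq_eqVlt h4 => /orP[/eqP ->|hi]; first by rewrite eqxx.
      by rewrite ltn_eqF // h1.
    + by move=> i hi; rewrite h4 gtn_eqF ?h2 //; lia.
    by rewrite h5 h3 big_ord_recr /= -ha addnA.
  case: eqP => [hm|/eqP hm].
    apply: (upd_case 0 0) => //; first by rewrite /flag hm eqxx.
      by rewrite /charge hm eqxx.
    by rewrite addn0.
  rewrite sem_cond 2!eval_or !eval_neq !vl vy vx.
  have -> : eval st2 (EGet aUsed (EVar vI)) = b j := hu.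
  have -> : eval st2 (ESub (EVar vR) (ECst 1)) = r.-1 by rewrite -subn1 -vr.
  rewrite vr (_ : (b j != 0 :> nat) || _ = ~~ swp (s j) (b j) r x y); last first.
    by rewrite /swp !negb_and negbK; case: (b j).
  case hsw: (swp _ _ _ _ _) => /=.
    by apply: (upd_case 1 0) => //=; rewrite ?addn0 // /flag /charge hm hsw.
  by apply: (upd_case 0 1) => //=; rewrite /flag /charge hm hsw.
split=> [i hi|]; first by rewrite h1 // hk.
by rewrite hk in h3; rewrite -h3 /= upd_neq.
Qed.

Lemma leave_ok st r x y acc best P : env st ->
  reg st vR = r -> reg st vX = x -> reg st vY = y -> reg st vAcc = acc ->
  reg st vBest = best -> is_min P best ->
  is_min (fun c => P c \/ exists2 i, i < k &
      [/\ s i r.+1 = y, s i r != x & c = acc + arr st aR (i * n + r)])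
    (reg (sem leave_cmd st) vBest).
Proof.
move=> he hr hx hy hacc hbest hmin.
have hk : reg st vK = k by case: he.
pose I j st' := is_min (fun c => P c \/ exists2 i, i < j &
      [/\ s i r.+1 = y, s i r != x & c = acc + arr st aR (i * n + r)]) (reg st' vBest).
have [||st1 hI ->] := @sem_for_agree I vI vK leave_step st; last by rewrite hk in hI *; exact: hI.
  rewrite /I hbest; apply: is_min_ext hmin _ => c; split; last by left.
  by case=> // -[].
move=> j st1; rewrite hk => hj hI hag.
have he1 := env_agree hag isT he; case: hag => hr1 ha1.
set st2 := set_reg vI j st1.
have he2 : env st2 by case: he1 => e1 e2 e3 e4.
have vl e : eval st2 (letter (EVar vI) e) = s j (eval st2 e) by rewrite eval_letter.
have vr : eval st2 (EVar vR) = r by rewrite -hr -hr1.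
have vr1 : eval st2 (EAdd (EVar vR) (ECst 1)) = r.+1 by have := vr => /= ->; rewrite addn1.
have vy : eval st2 (EVar vY) = y by rewrite -hy -hr1.
have vx : eval st2 (EVar vX) = x by rewrite -hx -hr1.
rewrite /leave_step !sem_cond !eval_neq !vl vr vr1 vy vx.
case: eqP => [h1|h1]; last first.
  apply: is_min_ext hI _ => c; split=> -[h|[i hi h]]; [by left| | by left | ]; right.
    by exists i => //; case: h => h2 _ _; move: hi; rewrite ltnS leq_eqVlt => /orP[/eqP hij|//];
      rewrite -h2 hij in h1.
  by exists i => //; lia.
case: eqP => [h2|/eqP h2].
  apply: is_min_ext hI _ => c; split=> -[h|[i hi h]]; [by left| | by left | ]; right.
    exists i => //; case: h => _ h3 _; move: hi; rewrite ltnS leq_eqVlt => /orP[/eqP hij|//].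
    by rewrite -h2 hij eqxx in h3.
  by exists i => //; lia.
have eb : reg (sem (Assign vBest (min_expr (EVar vBest) (EAdd (EVar vAcc)
    (edge_entry (EVar vI) (EVar vR))))) st2) vBest =
    minn (reg st1 vBest) (acc + arr st aR (j * n + r)).
  rewrite reg_assign eval_min; congr minn.
  have := eval_edge (i := EVar vI) (EVar vR) he2 hj; rewrite vr => e.
  by rewrite -hacc -hr1 // -ha1 // -e.
rewrite /I [reg _ _]eb; apply: is_min_step hI _ => c; split.
  case=> [h|[i hi h]]; first by left; left.
  case: (ltngtP i j) hi => [hij _|hij|hij _]; [|by lia|].
    by left; right; exists i.
  by right; case: h => _ _ ->; rewrite hij.
case=> [[h|[i hi h]]|->]; [by left | |]; right; first by exists i => //; lia.
by exists j.
Qed.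

Definition tables st l :=
  [/\ forall j, l <= j <= n -> suffix_opt k n sigma s j (arr st aC j), arr st aC n = 0 &
      forall j i, l <= j < n -> i < k ->
        edge_opt k n sigma s j i (arr st aR (i * n + j))].

Lemma edge_ok st l i0 : env st -> tables st l.+1 -> l < n -> i0 < k ->
  reg st vL = l -> reg st vI0 = i0 ->
  let st' := sem edge_cmd st in exists2 c, edge_opt k n sigma s l i0 c &
    forall x, arr st' aR x = if x == i0 * n + l then c else arr st aR x.
Proof.
move=> he ht hl hi hL hI0.
rewrite /edge_cmd 6!sem_then.
set a := altern (s i0 l.+1) (s i0 l) l.
set st1 := sem (Assign vBest _) _.
have [he1 hx1 hy1] : [/\ env st1, reg st1 vX = a l & reg st1 vY = a l.+1].
  rewrite /a altern0 altern1; case: he => e1 e2 e3 e4.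
  by split; rewrite // /st1 /= /upd /= ?hI0 ?hL e4 // e3 ?addn1.
have hacc1 : reg st1 vAcc = 0 by [].
have hbest1 : reg st1 vBest = arr st aC l.+1 by rewrite /st1 /= /upd /= hL addn1.
have hL1 : reg st1 vL = l by [].
have hI1 : reg st1 vI0 = i0 by [].
have har1 : arr st1 = arr st by [].
(* Only these facts about the state matter from here on; its defining term is forgotten to keep the
   goals small. *)
move: st1 he1 hx1 hy1 hacc1 hbest1 hL1 hI1 har1 => st1 he1 hx1 hy1 hacc1 hbest1 hL1 hI1 har1.
have hk1 : reg st1 vK = k by case: he1.
set st2 := sem clear_cmd st1.
have hu2 : forall i, i < k -> arr st2 aUsed i = false.
  have [||st' hI] := @sem_for (fun j st' => forall i, i < j -> arr st' aUsed i = 0)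
     vI vK clear_step st1; [by []| |by rewrite /st2 /clear_cmd => ->; rewrite -hk1].
  by move=> j st' _ h i; rewrite ltnS leq_eqVlt /= upd_eq; case: eqP => //= _; apply: h.
have ag2 : agree _ _ st1 st2 := sem_agree _ _.
have he2 := env_agree ag2 isT he1.
have hx2 : reg st2 vX = a l by rewrite (proj1 ag2).
have hy2 : reg st2 vY = a l.+1 by rewrite (proj1 ag2).
have hacc2 : reg st2 vAcc = 0 by rewrite (proj1 ag2).
have hbest2 : reg st2 vBest = arr st aC l.+1 by rewrite (proj1 ag2).
have hL2 : reg st2 vL = l by rewrite (proj1 ag2).
have hI2 : reg st2 vI0 = i0 by rewrite (proj1 ag2).
have haC2 : arr st2 aC = arr st aC by rewrite (proj2 ag2) // har1.
have haR2 : arr st2 aR = arr st aR by rewrite (proj2 ag2) // har1.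
clear ag2; move: st2 hu2 he2 hx2 hy2 hacc2 hbest2 hL2 hI2 haC2 haR2.
move=> st2 hu2 he2 hx2 hy2 hacc2 hbest2 hL2 hI2 haC2 haR2.
pose C := arr st aC; pose R j i := arr st aR (i * n + j).
(* [maxn j l.+1] is the next position to scan, since the rounds up to [l] are idle. *)
pose I j st' := [/\ reg st' vX = a (maxn j l.+1).-1, reg st' vY = a (maxn j l.+1),
  reg st' vAcc = total_cost k s a xpred0 l.+1 (j - l.+1),
  forall i, i < k -> arr st' aUsed i = flags (s i) a false l.+1 (j - l.+1) &
  is_min (edge_cand k s C R l i0 j) (reg st' vBest)].
have hn2 : reg st2 vN = n by case: he2.
have [||st3 hI3 e3] := @sem_for_agree I vR vN run_step st2.
- rewrite /I sub0n max0n total_nil; split=> //.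
  by rewrite hbest2; split=> [|c [->//|[r]]]; [left | lia].
- move=> j st3; rewrite hn2 => hj [hx hy hacc hu hmin] hag.
  have he3 := env_agree hag isT he2.
  set st4 := set_reg vR j st3.
  have he4 : env st4 by case: he3 => e1 e2 e3 e4.
  have hL4 : reg st4 vL = l by rewrite -hL2; apply: (proj1 hag).
  have hr4 : reg st4 vR = j by [].
  have haC4 : arr st4 aC = C by rewrite /C -haC2; apply: (proj2 hag).
  have haR4 : arr st4 aR = arr st aR by rewrite -haR2; apply: (proj2 hag).
  rewrite /run_step sem_cond (_ : eval st4 (ESub _ _) = j - l); last by rewrite -[in RHS]hL4.
  rewrite /I; case: (leqP j l) => hjl.
    have -> : (j - l != 0) = false by lia.
    rewrite (_ : maxn j.+1 l.+1 = maxn j l.+1); last by lia.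
    rewrite (_ : j.+1 - l.+1 = j - l.+1); last by lia.
    split=> //; apply: is_min_ext hmin _ => c; split=> -[->|[r hr h]]; by [left | lia].
  have -> : (j - l != 0) by lia.
  have mj : maxn j l.+1 = j by lia.
  rewrite mj in hx hy.
  have ej : l.+1 + (j - l.+1) = j by lia.
  have ej1 : j.+1 - l.+1 = (j - l.+1).+1 by lia.
  have [hu5 hacc5] := column_ok he4 hr4 hx hy hacc hu.
  have ag5 := sem_agree column_cmd st4.
  rewrite 3!sem_then; move: (sem column_cmd st4) hu5 hacc5 ag5 => st5 hu5 hacc5 ag5.
  have he5 := env_agree ag5 isT he4.
  have hx5 : reg st5 vX = a j.-1 by rewrite (proj1 ag5).
  have hy5 : reg st5 vY = a j by rewrite (proj1 ag5).
  have hr5 : reg st5 vR = j by rewrite (proj1 ag5).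
  have hb5 : reg st5 vBest = reg st3 vBest by rewrite (proj1 ag5).
  have haC5 : arr st5 aC = C by rewrite (proj2 ag5).
  have haR5 : arr st5 aR = arr st aR by rewrite (proj2 ag5).
  have {}hacc5 : reg st5 vAcc = run_cost k s l i0 j.
    rewrite hacc5 /run_cost (_ : j - l = (j - l.+1).+1); last by lia.
    rewrite /total_cost -big_split; apply: eq_bigr => i _.
    by rewrite scanS ej.
  have {}hu5 i : i < k -> arr st5 aUsed i = flags (s i) a false l.+1 (j.+1 - l.+1).
    by move=> hik; rewrite hu5 // ej1 flagsS ej.
  clear ag5.
  set st6 := sem (Assign vBest _) st5.
  have he6 : env st6 by case: he5 => e1 e2 e3 e4.
  have eb6 : reg st6 vBest = minn (reg st3 vBest) (run_cost k s l i0 j + C j.+1).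
    rewrite /st6 reg_assign eval_min /= hb5 hacc5 haC5.
    by have := hr5 => /= ->; rewrite addn1.
  have min6 : is_min (fun c => edge_cand k s C R l i0 j c \/ c = run_cost k s l i0 j + C j.+1)
      (reg st6 vBest) by rewrite eb6; apply: is_min_step hmin _ => c.
  have min7 := leave_ok he6 (hr5 : reg st6 vR = j) (hx5 : reg st6 vX = _)
    (hy5 : reg st6 vY = _) (hacc5 : reg st6 vAcc = _) erefl min6.
  have ag7 := sem_agree leave_cmd st6.
  move: (sem leave_cmd st6) min7 ag7 => st7 min7 ag7.
  have hx7 : reg st7 vX = a j.-1 by rewrite (proj1 ag7).
  have hy7 : reg st7 vY = a j by rewrite (proj1 ag7).
  have hacc7 : reg st7 vAcc = run_cost k s l i0 j by rewrite (proj1 ag7).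
  rewrite (_ : maxn j.+1 l.+1 = j.+1); last by lia.
  split.
  + exact: hy7.
  + by rewrite [LHS]hx7 /a alternS.
  + by rewrite [LHS]hacc7.
  + move=> i hik; rewrite -hu5 //.
    exact: (congr1 (fun f => f i) (proj2 ag7 aUsed isT)).
  apply: is_min_ext min7 _ => c; split.
    case=> [->|[r hr h]]; first by left; left; left.
    have [hrj|hrj] : r < j \/ r = j by lia.
      by left; left; right; exists r => //; lia.
    subst r; case: h => [->|[i2 hi2 [h1 h2 h3]]]; first by left; right.
    by right; exists i2 => //; split=> //; rewrite h3 [arr st6 _]haR5.
  case=> [[[->|[r hr h]]|->]|[i2 hi2 [h1 h2 h3]]]; first by left.
  + by right; exists r => //; lia.
  + by right; exists j; [lia | left].
  right; exists j; first lia.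
  by right; exists i2 => //; split=> //; rewrite h3 [arr st6 _]haR5.
rewrite [sem run_cmd st2]e3 hn2.
rewrite hn2 in hI3; case: hI3 => _ _ _ _ hmin3.
have ag3 := sem_agree run_cmd st2; rewrite [sem run_cmd st2]e3 hn2 in ag3.
exists (reg st3 vBest).
  case: ht => t1 t2 t3; apply: edge_optP hmin3 => // j i'; exact: inp_lt.
move=> x; have he3 := env_agree ag3 isT he2.
have hL3 := proj1 ag3 vL isT; have hI3 := proj1 ag3 vI0 isT.
have haR3 := proj2 ag3 aR isT.
rewrite -haR2 -haR3 /=; case: he3 => _ _ _ hrow.
have -> : upd (reg st3) vR n vI0 = i0 by rewrite -hI2 -hI3.
have -> : upd (reg st3) vR n vL = l by rewrite -hL2 -hL3.
by rewrite -[arr st3]/(arr (set_reg vR n st3)) hrow.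
Qed.

(** Reduction modulo [n] recovers the column. Hence writing one entry of the linearised table leaves
    the others valid. *)
Lemma entry_inj i i' j l : j < n -> l < n -> i * n + j = i' * n + l -> i = i' /\ j = l.
Proof.
move=> hj hl e; have ejl : j = l.
  by have := congr1 (modn^~ n) e; rewrite !modnMDl !modn_small.
split=> //; move: e; rewrite ejl => /addIn /eqP; rewrite eqn_pmul2r; first by move/eqP.
by lia.
Qed.

Lemma edges_ok st l : env st -> tables st l.+1 -> l < n -> reg st vL = l ->
  let st' := sem edges_cmd st in tables st' l.+1 /\
    forall i, i < k -> edge_opt k n sigma s l i (arr st' aR (i * n + l)).
Proof.
move=> he ht hl hL; have hk : reg st vK = k by case: he.
pose I j st' := tables st' l.+1 /\
  forall i, i < j -> edge_opt k n sigma s l i (arr st' aR (i * n + l)).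
have [||st1 hI ->] := @sem_for_agree I vI0 vK edge_cmd st; first by split.
  move=> j st1; rewrite hk => hj [h1 h2] hag.
  have he1 := env_agree hag isT he.
  set st2 := set_reg vI0 j st1.
  have he2 : env st2 by case: he1 => e1 e2 e3 e4.
  have hL2 : reg st2 vL = l by rewrite -hL; apply: (proj1 hag).
  have [c hc hR] := edge_ok he2 (h1 : tables st2 l.+1) hl hj hL2 erefl.
  have ag3 := sem_agree edge_cmd st2; move: (sem edge_cmd st2) hR ag3 => st3 hR ag3.
  split.
    case: h1 => t1 t2 t3; split; rewrite ?(proj2 ag3 aC isT) // => j' i hj' hi.
    by rewrite hR; case: eqP => [/entry_inj [||_]|_]; try lia; apply: t3.
  move=> i; rewrite ltnS hR => hij; case: eqP => [/entry_inj [||-> _ //]|hne]; try lia.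
  apply: h2; rewrite ltn_neqAle hij andbT; apply/eqP => e; apply: hne; by rewrite e.
by rewrite hk in hI.
Qed.

Lemma count_ok st l y : env st -> reg st vL = l -> reg st vY = y ->
  reg (sem count_cmd st) vAcc = mism k s l y.
Proof.
move=> he hL hY; rewrite /count_cmd sem_then.
set st0 := sem (Assign _ _) st.
have he0 : env st0 by case: he => e1 e2 e3 e4.
have hk : reg st0 vK = k by case: he0.
pose I j st' := reg st' vAcc = \sum_(i < j) (s i l != y).
have [||st1 hI ->] := @sem_for_agree I vI vK count_step st0.
- by rewrite /I big_ord0.
- move=> j st1; rewrite hk => hj hI hag.
  have he1 := env_agree hag isT he0.
  set st2 := set_reg vI j st1.
  have he2 : env st2 by case: he1 => e1 e2 e3 e4.
  have hL2 : eval st2 (EVar vL) = l by rewrite -hL; apply: (proj1 hag).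
  have hY2 : eval st2 (EVar vY) = y by rewrite -hY; apply: (proj1 hag).
  rewrite /count_step sem_cond eval_neq eval_letter // hL2 hY2 /I big_ord_recr -hI.
  rewrite (_ : eval st2 (EVar vI) = j) //=.
  by case: (s j l != y); rewrite ?reg_assign ?addn0.
by rewrite hk in hI.
Qed.

Lemma try_letter_ok st e rest l v : env st -> reg st vL = l ->
  (forall st', agree [:: vY; vAcc; vI] [::] st st' -> eval st' rest = v) ->
  let st' := sem (try_letter e rest) st in
  agree [:: vY; vAcc; vI; vBest] [::] st st' /\
  reg st' vBest = minn (reg st vBest) (mism k s l (eval st e) + v).
Proof.
move=> he hL hrest; rewrite /try_letter 2!sem_then.
set st1 := sem (Assign vY e) st.
have he1 : env st1 by case: he => e1 e2 e3 e4.
have hY1 : reg st1 vY = eval st e by rewrite /st1 reg_assign.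
have hacc := count_ok he1 (hL : reg st1 vL = l) hY1.
have [ag1 ag2] := sem_agree count_cmd st1.
move: (sem count_cmd st1) hacc ag1 ag2 => st2 hacc ag1 ag2.
have ag : agree [:: vY; vAcc; vI] [::] st st2.
  split=> [w|a _]; last by rewrite ag2.
  rewrite !inE !negb_or => /and3P[w1 w2 w3].
  by rewrite ag1 ?inE ?negb_or ?w2 ?w3 //= upd_neq.
split; last by rewrite reg_assign eval_min /= (hrest _ ag) hacc ag1.
case: ag => a1 a2; split=> [w|a _]; last by rewrite /= a2.
rewrite !inE !negb_or => /and4P[w1 w2 w3 w4].
by rewrite /= upd_neq // a1 // !inE !negb_or w1 w2.
Qed.

Lemma candidates_ok st l : env st -> reg st vL = l -> l < n ->
  reg st vBest = arr st aC l.+1 + k ->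
  is_min (suffix_cand k s (arr st aC) (fun j i => arr st aR (i * n + j)) l k)
    (reg (sem candidates_cmd st) vBest).
Proof.
move=> he hL hl hbest; have hk : reg st vK = k by case: he.
pose I j st' := is_min (suffix_cand k s (arr st aC) (fun j i => arr st aR (i * n + j)) l j)
   (reg st' vBest).
have [||st1 hI ->] := @sem_for_agree I vI0 vK candidates_step st.
- by rewrite /I hbest; split=> [|c [->//|[]//]]; left.
- move=> j st1; rewrite hk => hj hI hag.
  have he1 := env_agree hag isT he.
  set st2 := set_reg vI0 j st1.
  have he2 : env st2 by case: he1 => e1 e2 e3 e4.
  have hL2 : reg st2 vL = l by rewrite -hL; apply: (proj1 hag).
  have hI2 : reg st2 vI0 = j by [].
  have haC2 : arr st2 aC = arr st aC by apply: (proj2 hag).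
  have haR2 : arr st2 aR = arr st aR by apply: (proj2 hag).
  have hb2 : reg st2 vBest = reg st1 vBest by [].
  rewrite /candidates_step sem_then.
  have [|ag3 hb3] := @try_letter_ok st2 (letter (EVar vI0) (EVar vL))
     (next_suffix (EVar vL)) l (arr st aC l.+1) he2 hL2.
    by move=> st' [g1 g2]; rewrite /= g2 // g1 // haC2 addn1 hL2.
  move: (sem _ st2) ag3 hb3 => st3 ag3 hb3.
  rewrite eval_letter // [eval _ _]hI2 [eval _ _]hL2 hb2 in hb3.
  have he3 := env_agree ag3 isT he2.
  have hL3 : reg st3 vL = l by rewrite (proj1 ag3).
  have hI3 : reg st3 vI0 = j by rewrite (proj1 ag3).
  have [|ag4 hb4] := @try_letter_ok st3 (letter (EVar vI0) (EAdd (EVar vL) (ECst 1)))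
     (edge_entry (EVar vI0) (EVar vL)) l (arr st aR (j * n + l)) he3 hL3.
    move=> st' hag'; have he' := env_agree hag' isT he3; case: hag' => g1 g2.
    rewrite eval_edge //= ?g1 ?hI3 ?hL3 // g2 //.
    by rewrite (proj2 ag3) // haR2.
  rewrite /I hb4 hb3 eval_letter //=; last by rewrite hI3.
  rewrite hI3 hL3 addn1.
  apply: is_min_step (is_min_step hI _) _ => [c|c]; first by apply: iff_refl.
  split.
    case=> [->|[i hi h]]; first by left; left; left.
    have [hij|hij] : i < j \/ i = j by lia.
      by left; left; right; exists i.
    by subst i; case: h => ->; [left; right | right].
  case=> [[[->|[i hi h]]|->]|->]; first by left.
  + by right; exists i => //; lia.
  + by right; exists j => //; left.
  by right; exists j => //; right.
by rewrite hk in hI.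
Qed.

Lemma position_ok st j : env st -> reg st vJ = j -> j < n -> tables st (n - j) ->
  tables (sem position_cmd st) (n - j.+1).
Proof.
move=> he hJ hj ht; rewrite /position_cmd 4!sem_then.
have hn : reg st vN = n by case: he.
set st1 := sem (Assign vL _) st.
have he1 : env st1 by case: he => e1 e2 e3 e4.
set l := n - j.+1; have hl : l < n by rewrite /l; lia.
have hL1 : reg st1 vL = l by rewrite /st1 reg_assign /= hn hJ /l; lia.
have ht1 : tables st1 l.+1 by rewrite (_ : l.+1 = n - j) // /l; lia.
have [ht2 hR2] := edges_ok he1 ht1 hl hL1.
have ag2 := sem_agree edges_cmd st1.
move: (sem edges_cmd st1) ht2 hR2 ag2 => st2 ht2 hR2 ag2.
have he2 := env_agree ag2 isT he1.
have hL2 : reg st2 vL = l by rewrite (proj1 ag2).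
set st3 := sem (Assign vBest _) st2.
have he3 : env st3 by case: he2 => e1 e2 e3 e4.
have hb3 : reg st3 vBest = arr st3 aC l.+1 + k.
  by rewrite /st3 reg_assign /= addn1 hL2; case: he2 => ->.
have hmin := candidates_ok he3 (hL2 : reg st3 vL = l) hl hb3.
have ag4 := sem_agree candidates_cmd st3.
move: (sem candidates_cmd st3) hmin ag4 => st4 hmin ag4.
have hL4 : reg st4 vL = l by rewrite (proj1 ag4).
have hC4 : arr st4 aC = arr st2 aC by rewrite (proj2 ag4).
have hR4 : arr st4 aR = arr st2 aR by rewrite (proj2 ag4).
case: ht2 => t1 t2 t3.
have hopt : suffix_opt k n sigma s l (reg st4 vBest).
  apply: suffix_optP hmin => //; first by move=> *; apply: inp_lt.
  by apply: t1; lia.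
split; rewrite /= ?hL4 ?hC4 ?hR4.
- move=> j' hj'; case: eqP => [-> //|hne]; apply: t1; lia.
- by case: eqP => // h; move: hl; rewrite -h ltnn.
move=> j' i hj' hi; have [->|hne] : j' = l \/ l < j' by lia.
  exact: hR2.
by apply: t3 => //; lia.
Qed.

Lemma rows_ok st : reg st vK = k -> reg st vN = n -> (forall x, arr st aIn x = inp x) ->
  env (sem rows_cmd st).
Proof.
move=> hk hn hin; rewrite /rows_cmd sem_then.
set st0 := sem (Assign _ _) st.
pose I j st' := reg st' vAcc = j * n /\ forall i, i < j -> arr st' aRow i = i * n.
have [||st1 hI e1] := @sem_for_agree I vI vK rows_step st0; first by [].
  move=> j st1 _ [h1 h2] hag; split.
    rewrite /rows_step sem_then reg_assign /= !upd_neq // h1 mulSn addnC.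
    by rewrite (proj1 hag) // [reg _ _]hn.
  move=> i; rewrite ltnS leq_eqVlt /= upd_eq; case: eqP => [-> _|_ /= /h2 //].
  by rewrite upd_neq.
have ag := sem_agree (For vI vK rows_step) st0.
rewrite (_ : reg st0 vK = k) // in hI e1; case: hI => _ hI.
split; try by rewrite (proj1 ag).
  by move=> x; rewrite (proj2 ag) //; apply: hin.
by move=> i hi; rewrite e1; apply: hI.
Qed.

Lemma consensus_ok st : 0 < sigma ->
  reg st vK = k -> reg st vN = n -> (forall x, arr st aIn x = inp x) ->
  exists2 c, suffix_opt k n sigma s 0 c &
    reg (sem consensus_cmd st) vRes = (c <= reg st vD).
Proof.
move=> hsig hk hn hin; rewrite /consensus_cmd 3!sem_then.
have he1 := rows_ok hk hn hin; have ag1 := sem_agree rows_cmd st.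
move: (sem rows_cmd st) he1 ag1 => st1 he1 ag1.
set st2 := sem (Put _ _ _) st1.
have hn1 : reg st1 vN = n by case: he1.
have he2 : env st2 by case: he1 => e1 e2 e3 e4.
have ht2 : tables st2 n.
  split=> [j hj| |j i]; try (rewrite /st2 /= hn1); last by lia.
    have -> : j = n by lia.
    by rewrite eqxx; apply: suffix_opt_n.
  by rewrite eqxx.
have [||st3 ht3 e3] := @sem_for_agree (fun j st' => tables st' (n - j)) vJ vN position_cmd st2.
- by rewrite subn0.
- move=> j st3; rewrite (_ : reg st2 vN = n) // => hj ht hag.
  have he3 := env_agree hag isT he2.
  by apply: position_ok => //; case: he3 => e1 e2 e3 e4.
have ag3 := sem_agree (For vJ vN position_cmd) st2.
rewrite (_ : reg st2 vN = n) // in ht3 e3; rewrite subnn in ht3.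
have hC : arr (sem (For vJ vN position_cmd) st2) aC 0 = arr st3 aC 0 by rewrite e3.
have hD : reg (sem (For vJ vN position_cmd) st2) vD = reg st vD.
  by rewrite (proj1 ag3) // -(proj1 ag1).
case: ht3 => t1 _ _; exists (arr st3 aC 0); first exact: t1.
rewrite reg_assign; move: (sem (For vJ vN position_cmd) st2) hC hD => st4 hC hD.
by rewrite /= hC hD; lia.
Qed.

End Correctness.

(** * Freeing the low cells and moving the input *)

(** Starting from [2 * n + 1], cell 1 is doubled once for each unit of cell 0, with cell 3 holding
    the constant one; cell 2 keeps the bound [D]. *)
Definition encode_cmd :=
  Seq (Prim (IAdd 1 1 1)) (Seq (Prim (IConst 3 1)) (Seq (Prim (IAdd 1 1 3))
    (While 0 (Seq (Prim (IAdd 1 1 1)) (Prim (ISub 0 0 3)))))).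

(** Unrolled, because initially no cell is free for a pointer into the source: cell 0 is the target
    address and cell 3 the stride. *)
Fixpoint save_cells j :=
  if j is j'.+1 then
    Seq (save_cells j') (Seq (Prim (IAdd 0 0 3)) (Prim (IStore 0 (4 + j'))))
  else Prim (IConst 3 8).

(** The pointer advances by 8 before each store, hence 64, which is 8 below the offset 72 of the
    heap base. The 32 cells saved make room for the 20 variables and 12 temporaries. *)
Definition free_registers_cmd :=
  Seq (Prim (IConst 3 64)) (Seq (Prim (IAdd 0 1 3)) (save_cells 32)).

(** Cell 10 holds the number plus one, so cell 8 vanishes exactly when twice the current power
    exceeds the number. *)
Definition top_power_loop :=
  While 8 (Seq (Prim (IAdd 7 7 7)) (Seq (Prim (IAdd 4 4 9))
    (Seq (Prim (IAdd 8 7 7)) (Prim (ISub 8 10 8))))).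

(* Cell 6 holds the number being decoded; cells 4 and 7 end with the exponent and the value of its
   leading power of two. *)
Definition strip_top_bit :=
  Seq (Prim (IConst 7 1)) (Seq (Prim (IConst 4 0)) (Seq (Prim (IAdd 8 7 7))
 (Seq (Prim (IAdd 10 6 9)) (Seq (Prim (ISub 8 10 8)) (Seq top_power_loop
      (Prim (ISub 6 6 7))))))).

(** Once the digits are exhausted, cell 7 holds [2 ^ k]; then [n] is the number of times twice this
    power can be subtracted from the code minus [2 ^ k]. *)
Definition decode_cmd :=
  Seq (Prim (IConst 3 0)) (Seq (Prim (IConst 9 1)) (Seq (Prim (IAdd 6 1 3))
 (Seq (While 6 strip_top_bit)
 (Seq (Prim (ISub 6 1 7)) (Seq (Prim (IConst 5 0))
      (While 6 (Seq (Prim (ISub 6 6 7)) (Seq (Prim (ISub 6 6 7))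
        (Prim (IAdd 5 5 9)))))))))).

(** Since 32 letters are already in the heap and cell 0 still points at the last of them, copying
    resumes at cell 36 and lasts [k * n - 32] rounds. *)
Definition copy_cmd :=
  Seq (Prim (IConst 6 0)) (Seq (Prim (IAdd 7 4 3))
 (Seq (While 7 (Seq (Prim (IAdd 6 6 5)) (Prim (ISub 7 7 9))))
 (Seq (Prim (IConst 7 32)) (Seq (Prim (ISub 6 6 7))
 (Seq (Prim (IConst 7 36)) (Seq (Prim (IConst 8 8))
 (Seq (While 6 (Seq (Prim (IAdd 0 0 8)) (Seq (Prim (ILoad 10 7))
        (Seq (Prim (IStore 0 10)) (Seq (Prim (IAdd 7 7 9)) (Prim (ISub 6 6 9)))))))
 (Seq (Prim (IAdd (var_addr vD) 2 3)) (Seq (Prim (IConst 8 72))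
      (Prim (IAdd 1 1 8))))))))))).

Definition solve_cmd :=
  Seq encode_cmd (Seq free_registers_cmd (Seq decode_cmd (Seq copy_cmd
 (Seq (ccmd consensus_cmd) (Prim (IAdd 0 (var_addr vRes) 3)))))).

(** For [n = 0] the empty string has distance 0 to every input. For [k = 0] the sum is empty, but a
    string of positive length exists only over a nonempty alphabet, hence the test of cell 3. *)
Definition main_cmd :=
  If 1 (If 0 solve_cmd (If 3 (Prim (IConst 0 1)) (Prim (IConst 0 0))))
       (Prim (IConst 0 1)).

(** * Correctness of the passage from the raw input to the heap *)

Section Prologue.
Variables (k n D : nat) (m0 : memory).
Hypotheses (hk : 0 < k) (hn : 0 < n).
Hypotheses (m0k : m0 0 = k) (m0n : m0 1 = n) (m0D : m0 2 = D).
Hypothesis m0_out : forall x, 4 + k * n <= x -> m0 x = 0.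

Let E := 2 ^ k * (2 * n + 1).
(** The offset keeps the base above the 36 low cells even for a small code; for [k = n = 1] the code
    is only 6. *)
Let B := E + 72.

Lemma code_ge : 4 + k * n <= E.
Proof.
rewrite /E; have : k < 2 ^ k by apply: ltn_expl.
by nia.
Qed.

Lemma ok_encode : ok encode_cmd m0 (k * 4 + 4)
  (fun m => [/\ m 0 = 0, m 1 = E, m 2 = D & forall x, 4 <= x -> m x = m0 x]).
Proof.
rewrite /encode_cmd !addnS; do 3! apply: ok_seq_prim => //.
pose I j m := [/\ m 0 = j /\ j <= k, m 1 = 2 ^ (k - j) * (2 * n + 1), m 3 = 1, m 2 = D &
  forall x, 4 <= x -> m x = m0 x].
have hI : I k (prim_step (IAdd 1 1 3) (prim_step (IConst 3 1) (prim_step (IAdd 1 1 1) m0))).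
  rewrite /I subnn expn0 mul1n; split=> //; rewrite /= /upd /= ?m0n; first by lia.
  by move=> [|[|[|[|x]]]].
rewrite addn0; apply: ok_weaken (ok_while (T := 2) hI _ _) _ _ => //.
- by move=> j m [[-> _]].
- move=> j m [[h0 hj] h1 h3 h2 hx].
  apply: ok_seq_prim => //; apply: ok_prim => //; split; rewrite /= /upd //=.
  + by rewrite h0 h3; lia.
  + by rewrite h1 (_ : k - j = (k - j.+1).+1) ?expnS ?addnn -?mul2n ?mulnA //; lia.
  by move=> [|[|[|[|x]]]] //= hx'; apply: hx.
by move=> m [[-> _] + _ -> h]; rewrite subn0; split.
Qed.

(* The memory after the first [c] input cells have been copied to their entries of array 0. *)
Definition heap c x :=
  if [&& B <= x, (x - B) %% 8 == 0 & (x - B) %/ 8 < c] then m0 (4 + (x - B) %/ 8)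
  else m0 x.

Lemma heap_low c x : x < B -> heap c x = m0 x.
Proof. by rewrite /heap ltnNge => /negbTE ->. Qed.

Lemma heap0 x : heap 0 x = m0 x.
Proof. by rewrite /heap !andbF. Qed.

Lemma heapS c x : heap c.+1 x = if x == B + 8 * c then m0 (4 + c) else heap c x.
Proof.
rewrite /heap; case: (x =P B + 8 * c) => [->|hne].
  by rewrite addKn modnMr mulKn // ltnSn leq_addr.
suff -> : [&& B <= x, (x - B) %% 8 == 0 & (x - B) %/ 8 < c.+1] =
          [&& B <= x, (x - B) %% 8 == 0 & (x - B) %/ 8 < c] by [].
by move: B hne => b hne; lia.
Qed.

(** An entry not copied reads zero, and so does the cell it would come from, since both lie beyond
    the input. *)
Lemma heap_input c i : k * n <= c -> heap c (B + 8 * i) = m0 (4 + i).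
Proof.
move=> hc; rewrite /heap leq_addr addKn modnMr mulKn //=.
by case: ltnP => // hi; rewrite !m0_out //; have := code_ge; rewrite /B; lia.
Qed.

Definition frame d h m := [/\ m 0 = d, m 1 = E, m 2 = D, m 3 = 0 &
  forall x, num_regs <= x -> m x = h x].

Lemma frame_upd d h m r v : 4 <= r < num_regs -> frame d h m -> frame d h (upd m r v).
Proof.
by move=> hr [h0 h1 h2 h3 hx]; split=> [||||x hx']; rewrite upd_neq ?h0 ?h1 ?h2 ?h3 ?hx //; lia.
Qed.

Lemma ok_free_registers m : 
  [/\ m 0 = 0, m 1 = E, m 2 = D & forall x, 4 <= x -> m x = m0 x] ->
  ok free_registers_cmd m 67 (fun m' =>
    [/\ m' 0 = E + 320, m' 1 = E, m' 2 = D & forall x, 4 <= x -> m' x = heap 32 x]).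
Proof.
move=> [h0 h1 h2 hx]; rewrite /free_registers_cmd; do 2! apply: ok_seq_prim => //.
set m1 := prim_step _ _.
have save j : j <= 32 -> ok (save_cells j) m1 (1 + j * 2) (fun m' =>
  [/\ m' 0 = E + 64 + 8 * j, m' 1 = E, m' 2 = D, m' 3 = 8 &
      forall x, 4 <= x -> m' x = heap j x]).
  elim: j => [|j IH] hj.
    apply: ok_prim => //; rewrite /m1 /= /upd /=; split=> // [|x hx4]; first by rewrite h1 addn0.
    by rewrite heap0 -hx //; move: hx4; case: x => [|[|[|[|x]]]].
  rewrite (_ : 1 + j.+1 * 2 = (1 + j * 2) + 2); last by lia.
  apply: ok_seq (IH (ltnW hj)) _ => m2 [g0 g1 g2 g3 gx].
  apply: ok_seq_prim => //; apply: ok_prim => //=.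
  have ad : upd m2 0 (m2 0 + m2 3) 0 = B + 8 * j by rewrite upd_eq g0 g3 /B; lia.
  have va : upd m2 0 (m2 0 + m2 3) (4 + j) = m0 (4 + j).
    by rewrite upd_neq // gx // heap_low //; have := code_ge; rewrite /B; lia.
  rewrite ad va.
  split=> [||||x hx4]; try (rewrite upd_neq /B; last by lia).
  + by rewrite upd_eq g0 g3; lia.
  + by rewrite upd_neq.
  + by rewrite upd_neq.
  + by rewrite upd_neq.
  by rewrite heapS -gx // /upd; case: (x == B + 8 * j) => //; case: x hx4.
apply: ok_weaken (save 32 isT) _ _ => // m' [g0 g1 g2 _ gx]; split=> //.
by rewrite g0; lia.
Qed.

Lemma ok_top_power d h m r : 0 < r -> frame d h m ->
  m 4 = 0 -> m 6 = r -> m 7 = 1 -> m 8 = r.+1 - 2 -> m 9 = 1 -> m 10 = r.+1 ->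
  ok top_power_loop m (trunc_log 2 r * 6 + 1) (fun m' =>
    [/\ frame d h m', m' 4 = trunc_log 2 r, m' 6 = r, m' 7 = 2 ^ trunc_log 2 r & m' 9 = 1]).
Proof.
move=> hr hf h4 h6 h7 h8 h9 h10; set c := trunc_log 2 r.
have /andP[lo hi] := trunc_log_bounds (isT : 1 < 2) hr; rewrite -/c in lo hi.
pose I j m := [/\ frame d h m /\ j <= c, m 4 = c - j /\ m 6 = r, m 7 = 2 ^ (c - j),
  m 8 = r.+1 - 2 * 2 ^ (c - j) & m 9 = 1 /\ m 10 = r.+1].
have hI : I c m by rewrite /I subnn.
rewrite /top_power_loop addn1; apply: ok_weaken (ok_while (T := 4) hI _ _) _ _ => //.
- move=> j m1 [[_ hj] _ _ -> _]; rewrite subn_eq0 -expnS; case: j hj => [_|j hj].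
    by rewrite subn0.
  rewrite ltnNge (leq_trans _ lo) // leq_exp2l //; lia.
- move=> j m1 [[g0 hj] [g4 g6] g7 g8 [g9 g10]].
  have e : c - j = (c - j.+1).+1 by lia.
  do 3! apply: ok_seq_prim => //; apply: ok_prim => //; split.
  + by split; [do 4! (apply: frame_upd => //) | lia].
  + by rewrite /= /upd /= g4 g9 g6 e addn1.
  + by rewrite /= /upd /= g7 e expnS mul2n addnn.
  + by rewrite /= /upd /= g10 g7 e expnS; lia.
  by rewrite /= /upd /=.
by move=> m1 [[g0 _] [g4 g6] g7 _ [g9 _]]; rewrite subn0 in g4 g7; split.
Qed.

(* Removing the leading binary digit of [2 ^ k * (2 * q + 1)] keeps its shape until only [2 ^ k]
   is left, which reveals [k]. *)
Lemma trunc_log_odd_part q : let c := trunc_log 2 (2 ^ k * (2 * q + 1)) in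
  [/\ c <= k + q, 0 < q -> exists2 q', q' < q &
       2 ^ k * (2 * q + 1) - 2 ^ c = 2 ^ k * (2 * q' + 1) & q = 0 -> c = k].
Proof.
have hr : 0 < 2 ^ k * (2 * q + 1) by rewrite muln_gt0 expn_gt0; lia.
move=> c; have /andP[lo hi] := trunc_log_bounds (isT : 1 < 2) hr; rewrite -/c in lo hi.
have q2 : 2 * q + 1 < 2 ^ q.+1 by rewrite expnS; have := ltn_expl q (isT : 1 < 2); lia.
split.
- rewrite -ltnS -(ltn_exp2l _ _ (isT : 1 < 2)) -addnS expnD.
  by apply: leq_ltn_trans lo _; rewrite ltn_pmul2l // expn_gt0.
(* For [q > 0] the leading power is a multiple of [2 ^ k.+1], so removing it only lowers [q]. *)
- move=> hq; have hc : k < c.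
    rewrite -ltnS -(ltn_exp2l _ _ (isT : 1 < 2)); apply: leq_ltn_trans hi.
    by rewrite expnSr leq_pmul2l ?expn_gt0 //; lia.
  have e : 2 ^ c = 2 ^ k * (2 * 2 ^ (c - k.+1)) by rewrite -expnS -expnD; congr (_ ^ _); lia.
  have hle : 2 * 2 ^ (c - k.+1) <= 2 * q + 1.
    by rewrite -(leq_pmul2l (_ : 0 < 2 ^ k)) ?expn_gt0 // -e.
  have := expn_gt0 2 (c - k.+1) => /= h0.
  exists (q - 2 ^ (c - k.+1)); first by lia.
  by rewrite e -mulnBr; congr (_ * _); lia.
move=> q0; apply/eqP; rewrite eqn_leq; move: lo hi; rewrite q0 muln1 leq_exp2l // ltn_exp2l //.
by move=> ->.
Qed.

Lemma ok_decode d h m : m 0 = d -> m 1 = E -> m 2 = D -> (forall x, 4 <= x -> m x = h x) ->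
  ok decode_cmd m (n.+1 * ((k + n) * 6 + 9) + n * 5 + 7) (fun m' =>
    [/\ frame d h m', m' 4 = k, m' 5 = n & m' 9 = 1]).
Proof.
move=> h0 h1 h2 hx; rewrite /decode_cmd.
have -> : n.+1 * ((k + n) * 6 + 9) + n * 5 + 7 =
  ((n.+1 * ((k + n) * 6 + 7).+2).+1 + (n * 5).+1.+2).+3 by nia.
do 3! apply: ok_seq_prim => //.
set m1 := prim_step _ _.
have f1 : frame d h m1.
  split; rewrite /m1 /= /upd //= => x hx'.
  by rewrite -hx; [do 3! (case: eqP; first by lia) | lia].
(* Index [q.+1] stands for the odd part [2 * q + 1], index 0 for an exhausted cell 6. As [q] drops
   in every round, there are at most [n.+1] rounds, each linear in [k + n]. *)
pose I j m := [/\ frame d h m, m 9 = 1 &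
  if j is q.+1 then q <= n /\ m 6 = 2 ^ k * (2 * q + 1)
  else [/\ m 6 = 0, m 4 = k & m 7 = 2 ^ k]].
have I1 : I n.+1 m1 by split=> //; rewrite /m1 /= /upd /= h1 addn0.
apply: ok_seq (ok_while_le (T := (k + n) * 6 + 7) I1 _ _) _.
- move=> [|q] m2 [_ _]; first by case=> ->.
  by case=> _ ->; rewrite muln_eq0 expn_eq0 /=; lia.
- move=> q m2 [f2 g9 [hq g6]]; rewrite /strip_top_bit.
  set r := 2 ^ k * (2 * q + 1) in g6 *.
  have hr : 0 < r by rewrite /r muln_gt0 expn_gt0; lia.
  have [c1 c2 c3] := trunc_log_odd_part q; rewrite -/r in c1 c2 c3.
  apply: (@ok_weaken _ _ (((trunc_log 2 r * 6 + 1) + 1).+1.+4)) => //; [|by lia|by move=> m' h'; exact: h'].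
  do 5! apply: ok_seq_prim => //.
  set m3 := prim_step _ _.
  apply: ok_seq (ok_top_power (d := d) (h := h) (r := r) hr _ _ _ _ _ _ _) _.
  + by do 5! (apply: frame_upd => //).
  + by rewrite /m3 /= /upd /=.
  + by rewrite /m3 /= /upd /=.
  + by rewrite /m3 /= /upd /=.
  + by rewrite /m3 /= /upd /= g6 g9 addn1.
  + by rewrite /m3 /= /upd /=.
  + by rewrite /m3 /= /upd /= g6 g9 addn1.
  move=> m4 [f4 k4 k6 k7 k9]; apply: ok_prim => //.
  have f5 : frame d h (prim_step (ISub 6 6 7) m4) by apply: frame_upd.
  case: (posnP q) => [q0|/c2 [q' hq' e]].
    exists 0 => //; split=> //; rewrite /= /upd /= k4 k6 k7 c3 //; split=> //.
    by rewrite /r q0 muln1 subnn.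
  by exists q'.+1 => //; split=> //; split; [lia | rewrite /= /upd /= k6 k7].
move=> m2 [f2 g9 [g6 g4 g7]]; do 2! apply: ok_seq_prim => //.
pose J j m := [/\ frame d h m, m 9 = 1, m 4 = k /\ m 7 = 2 ^ k,
   m 6 = 2 ^ k * (2 * j) & m 5 = n - j /\ j <= n].
have [_ k1 _ _ _] := f2.
apply: ok_weaken (ok_while (T := 3) (I := J) (j := n) _ _ _) _ _ => //.
- split; rewrite /= /upd //=; first by do 2! (apply: frame_upd => //).
    by rewrite k1 g7 /E mulnDr muln1 addnK.
  by rewrite subnn.
- by move=> j m3 [_ _ _ -> _]; rewrite !muln_eq0 expn_eq0.
- move=> j m3 [f3 l9 [l4 l7] l6 [l5 hj]].
  do 2! apply: ok_seq_prim => //; apply: ok_prim => //; split; rewrite /= /upd //=.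
  + by do 3! (apply: frame_upd => //).
  + by rewrite l6 l7 mulnS mulnDr; nia.
  by rewrite l5 l9; lia.
by move=> m3 [f3 l9 [l4 _] _ [l5 _]]; split=> //; rewrite l5 subn0.
Qed.

Lemma ok_copy m : frame (E + 320) (heap 32) m -> m 4 = k -> m 5 = n -> m 9 = 1 ->
  ok copy_cmd m (k * 4 + k * n * 7 + 11) (fun m' => exists2 c, k * n <= c &
    [/\ m' 1 = B, m' 3 = 0, m' 4 = k, m' 5 = n & m' 6 = D /\
        forall x, num_regs <= x -> m' x = heap c x]).
Proof.
move=> hf h4 h5 h9; rewrite /copy_cmd.
apply: (@ok_weaken _ _ ((k * 4).+1 + (((k * n - 32) * 7).+1 + 3).+4).+2); [|by lia|by move=> m' h'; exact: h'].
do 2! apply: ok_seq_prim => //.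
set m1 := prim_step _ _.
pose I j m := [/\ frame (E + 320) (heap 32) m, m 4 = k /\ j <= k, m 5 = n,
  m 6 = (k - j) * n & m 7 = j /\ m 9 = 1].
have h3 : m 3 = 0 by case: hf.
have I1 : I k m1.
  split; rewrite /m1 /= /upd //=; first by do 2! (apply: frame_upd => //).
    by rewrite subnn.
  by rewrite h3 h4 addn0.
apply: ok_seq (ok_while (T := 2) I1 _ _) _.
- by move=> j m2 [_ _ _ _ [->]].
- move=> j m2 [f2 [g4 hj] g5 g6 [g7 g9]].
  apply: ok_seq_prim => //; apply: ok_prim => //; split; rewrite /= /upd //=.
  + by do 2! (apply: frame_upd => //).
  + by split; [|lia].
  + by rewrite g6 g5 (_ : k - j = (k - j.+1).+1) ?mulSn; lia.
  by rewrite g7 g9 subn1.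
move=> m2 [f2 [g4 _] g5 g6 [_ g9]]; rewrite subn0 in g6.
do 4! apply: ok_seq_prim => //.
set m3 := prim_step _ _; set e := k * n - 32.
(* [c] cells are copied and [j] remain; if [k * n] is below 32, then [e] is 0 and [c] stays at
   32. *)
pose J j m := exists2 c, c + j = 32 + e & 
  [/\ frame (E + 64 + 8 * c) (heap c) m, 32 <= c, m 4 = k /\ m 5 = n, 
      m 6 = j /\ m 7 = 4 + c & m 8 = 8 /\ m 9 = 1].
have J3 : J e m3.
  exists 32 => //; split; rewrite /m3 /= /upd //=; last by rewrite g6.
  rewrite (_ : E + 64 + _ = E + 320); last by lia.
  by do 4! (apply: frame_upd => //).
apply: (@ok_seq _ _ _ (e * 7).+1 3 _ (J 0)).
  apply: (ok_while (T := 5)) J3 _ _; first by move=> j m4 [c _ [_ _ _ [-> _] _]].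
  move=> j m4 [c hc [f4 hc32 [k4 k5] [k6 k7] [k8 k9]]].
  have [d0 d1 d2 d3 dx] := f4.
  have hcn : c < k * n by move: hc; rewrite /e; lia.
  have hEge := code_ge.
  do 4! apply: ok_seq_prim => //; apply: ok_prim => //.
  exists c.+1; first by lia.
  have -> : prim_step (ILoad 10 7) (prim_step (IAdd 0 0 8) m4) =
     upd (upd m4 0 (B + 8 * c)) 10 (m0 (4 + c)).
    rewrite /= d0 k8 (_ : E + 64 + 8 * c + 8 = B + 8 * c); last by rewrite /B; lia.
    congr (upd _ 10 _); rewrite (upd_neq _ _ (isT : 7 != 0)) k7 upd_neq //.
    by rewrite dx ?heap_low // ?/B; lia.
  set m5 := upd _ 10 _.
  have f5 : [/\ m5 0 = B + 8 * c, m5 1 = E, m5 2 = D, m5 3 = 0 &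
      forall x, num_regs <= x -> m5 x = heap c x].
    split; rewrite /m5 /upd //= => x hx.
    by rewrite -dx //; do 2! (case: eqP; first by lia).
  rewrite (_ : prim_step (IStore 0 10) m5 = upd m5 (B + 8 * c) (m0 (4 + c))) //.
  have hB : forall x, x < num_regs -> upd m5 (B + 8 * c) (m0 (4 + c)) x = m5 x.
    by move=> x hx; rewrite upd_neq // /B; lia.
  have f6 : frame (E + 64 + 8 * c.+1) (heap c.+1) (upd m5 (B + 8 * c) (m0 (4 + c))).
    case: f5 => e0 e1 e2 e3 ex; split; rewrite ?hB // ?e0; first by rewrite /B; lia.
    by move=> x hx; rewrite heapS -ex.
  move: (upd m5 (B + 8 * c) _) hB f6 => m6 hB f6.
  split.
  + by do 2! (apply: frame_upd => //).
  + by lia.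
  + by rewrite /= /upd /= !hB.
  + by rewrite /= /upd /= !hB // /m5 /upd /= k6 k7 k9; split; lia.
  by rewrite /= /upd /= !hB.
move=> m4 [c hc [[_ d1 d2 d3 dx] _ [k4 k5] _ _]].
do 2! apply: ok_seq_prim => //; apply: ok_prim => //.
exists c; first by move: hc; rewrite /e; lia.
split; rewrite /= /upd /= ?d1 //; split; first by rewrite d2 d3 addn0.
move=> x hx; rewrite -dx //; do 3! (case: eqP; first by rewrite /var_addr; lia).
by [].
Qed.

Lemma ok_solve sigma : 0 < sigma -> (forall x, m0 (4 + x) < sigma) ->
  ok solve_cmd m0 (2000 * (k ^ 2 * n ^ 2)) (fun m => exists2 c,
    suffix_opt k n sigma (in_letter n (fun x => m0 (4 + x))) 0 c & m 0 = (c <= D)).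
Proof.
move=> hsig hlt; rewrite /solve_cmd.
have hcost := ccost_consensus hk hn.
apply: (@ok_weaken _ _ ((k * 4 + 4) + (67 + ((n.+1 * ((k + n) * 6 + 9) + n * 5 + 7) +
  ((k * 4 + k * n * 7 + 11) + (ccost k n consensus_cmd + 1)))))); [| |by move=> m h; exact: h].
  apply: ok_seq ok_encode _ => m1 h1.
  apply: ok_seq (ok_free_registers h1) _ => m2 [g0 g1 g2 gx].
  apply: ok_seq (ok_decode g0 g1 g2 gx) _ => m3 [f3 k4 k5 k9].
  apply: ok_seq (ok_copy f3 k4 k5 k9) _ => m4 [c hc [e1 e3 e4 e5 [e6 ex]]].
  have hB : num_regs <= B by rewrite /B; lia.
  set st := State (fun v => m4 (var_addr v)) (fun a i => m4 (B + 8 * i + a)).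
  have hrel : represents B st m4 by split.
  have hin x : arr st aIn x = m0 (4 + x).
    by rewrite /= addn0 ex ?heap_input //; lia.
  have [c' hc' hres] := consensus_ok hlt hsig (e4 : reg st vK = k) (e5 : reg st vN = n) hin.
  have := ok_ccmd hB cwf_consensus hrel.
  rewrite [reg st 0]e4 [reg st 1]e5 => hok.
  apply: ok_seq hok _ => m5 [r1 r3 rv _]; apply: ok_prim => //.
  exists c' => //; rewrite /= upd_eq rv // r3 addn0 hres.
  by rewrite [reg st vD]e6.
move: hcost; move: (ccost _ _ _) => z hz; nia.
Qed.

End Prologue.

(** * From the memory image back to the strings *)

Section Encoding.
Variables (T : finType) (k n D : nat) (S : 'I_k -> seq T).
Hypothesis size_S : forall i, size (S i) = n.
Hypothesis (hn : 0 < n).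

Let inp x := (encode_input n D S).2 (4 + x).

Lemma encode_inputE x : inp x =
  if x %/ n < k then
    (if [pick i' : 'I_k | val i' == x %/ n] is Some i' then
       (if onth (S i') (x %% n) is Some a then val (enum_rank a) else 0)
     else 0)
  else 0.
Proof.
rewrite /inp /encode_input /= -[4 + x]/(x.+4) /=.
by rewrite (_ : x.+4 - 4 = x) ?(negbTE (lt0n_neq0 hn)) //; lia.
Qed.

Lemma encode_input_lt x : 0 < #|T| -> inp x < #|T|.
Proof.
move=> hT; rewrite encode_inputE; case: ifP => // _; case: pickP => // i _.
by case: onth => // a; apply: ltn_ord.
Qed.

Lemma encode_input_out x : k * n <= x -> inp x = 0.
Proof. by move=> h; rewrite encode_inputE ltnNge leq_divRL // h. Qed.

Lemma encode_input_letter x0 (i : 'I_k) j : j < n ->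
  in_letter n inp i j = enum_rank (nth x0 (S i) j).
Proof.
move=> hj; rewrite /in_letter encode_inputE divnMDl // divn_small // addn0 ltn_ord.
rewrite modnMDl modn_small //; case: pickP => [i' /eqP /val_inj ->|/(_ i)]; last first.
  by rewrite eqxx.
have := onthTE (S i) j; rewrite size_S hj; case e: onth => [a|] // _.
by rewrite (@onth_nth _ x0 _ _ _ e).
Qed.

Lemma sh_dist_scan (x0 : T) (i : 'I_k) (t : n.-tuple T) :
  sh_dist (S i) t =
  scan (in_letter n inp i) (fun j => enum_rank (nth x0 t j)) true 0 n.
Proof.
have hs : size (S i) = size t by rewrite size_S size_tuple.
have finj : injective (fun x : T => val (enum_rank x)).
  by move=> x y /val_inj /enum_rank_inj.
rewrite sh_distE // -(gdist_map _ _ finj) -gdist_scan; congr gdist.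
  apply: (@eq_from_nth _ 0) => [|j]; rewrite !(size_map, size_S, size_iota) // => hj.
  rewrite (nth_map x0) ?size_S // (nth_map 0) ?size_iota // nth_iota //.
  by rewrite add0n (encode_input_letter x0).
apply: (@eq_from_nth _ 0) => [|j]; rewrite !(size_map, size_tuple, size_iota) // => hj.
by rewrite (nth_map x0) ?size_tuple // (nth_map 0) ?size_iota // nth_iota.
Qed.

Lemma consensus_suffix_opt c : 0 < k ->
  suffix_opt k n #|T| (in_letter n inp) 0 c -> consensus_SH n D S = (c <= D).
Proof.
move=> hk [hmin [v [hv hc]]]; rewrite subn0 in hmin hc.
have x0 : T.
  by have := size_S (Ordinal hk); case: (S _) => [h|x w _]; [move: hn; rewrite -h | exact: x].
apply/existsP/idP => [[t ht]|hcD].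
  apply: leq_trans (hmin (fun j => enum_rank (nth x0 t j))) _.
  apply: leq_trans ht; apply: leq_sum => i _; by rewrite (sh_dist_scan x0).
exists [tuple enum_val (Ordinal (hv i)) | i < n].
apply: leq_trans hcD; apply: leq_trans hc; apply: leq_sum => i _.
rewrite (sh_dist_scan x0) (@scan_ext _ _ v) // => j hj.
have hjn : j < n by lia.
by rewrite -[j]/(val (Ordinal hjn)) -tnth_nth tnth_mktuple enum_valK.
Qed.

End Encoding.

Lemma ok_decides c m T b : ok c m T (fun m' => m' 0 = nat_of_bool b) ->
  decides_within (compile 0 c ++ [:: IHalt]) T (0, m) b.
Proof.
move=> [t [m' [h ht hm]]]; exists t; split=> //.
rewrite (exec_run h) => [|j hj]; last by rewrite add0n nth_cat hj.
by rewrite add0n /halted [_.1]/= nth_cat size_compile ltnn subnn.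
Qed.

Lemma main_decides (T : finType) (k n D : nat) (S : 'I_k -> seq T) :
  (forall i, size (S i) = n) ->
  decides_within (compile 0 main_cmd ++ [:: IHalt]) (2000 * (k ^ 2 * n ^ 2) + 7)
    (encode_input n D S) (consensus_SH n D S).
Proof.
move=> size_S; set m0 := (encode_input n D S).2.
apply: (@ok_decides main_cmd m0).
have const (b : bool) N : 0 < N -> b = consensus_SH n D S ->
    ok (Prim (IConst 0 b)) m0 N (fun m => m 0 = consensus_SH n D S).
  move=> hN <-; apply: (@ok_weaken _ _ 1 _ (fun m => m 0 = b)) => //.
  by apply: ok_prim => //=; rewrite upd_eq.
rewrite (_ : _ + 7 = (2000 * (k ^ 2 * n ^ 2) + 5).+2); last by lia.
apply: ok_if => [hn|/eqP hn]; last first.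
  have {}hn : n = 0 by [].
  apply: (const true); first by lia.
  apply/esym.
  apply/existsP.
  subst n; exists [tuple]; rewrite big1 // => i _.
  rewrite sh_distE ?size_S //.
  by have /size0nil -> := size_S i.
have {}hn : 0 < n by rewrite lt0n; apply: hn.
rewrite (_ : _ + 5 = (2000 * (k ^ 2 * n ^ 2) + 3).+2); last by lia.
apply: ok_if => [hk|/eqP hk].
  have {}hk : 0 < k by rewrite lt0n; apply: hk.
  have hT : 0 < #|T|.
    have := size_S (Ordinal hk); case: (S _) => [h|x w _]; first by move: hn; rewrite -h.
    by apply/card_gt0P; exists x.
  have hlt x := encode_input_lt D S hn x hT.
  have hout x : 4 + k * n <= x -> m0 x = 0.
    by move=> hx; rewrite -(encode_input_out D S hn (x := x - 4)); [congr (_.2 _) |]; lia.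
  have hs := ok_solve hk hn (erefl : m0 0 = k) (erefl : m0 1 = n) (erefl : m0 2 = D)
    hout hT hlt.
  apply: ok_weaken hs _ _; first by lia.
  by move=> m [c hc ->]; rewrite (consensus_suffix_opt size_S hn hk hc).
have {}hk : k = 0 by [].
have cons0 : consensus_SH n D S = (#|T| != 0).
  subst k; apply/existsP/idP => [[t _]|].
    by rewrite -lt0n; apply/card_gt0P; exists (tnth t (Ordinal hn)).
  rewrite -lt0n => /card_gt0P [x _]; exists [tuple of nseq n x]; by rewrite big_ord0.
rewrite (_ : _ + 3 = (2000 * (k ^ 2 * n ^ 2) + 1).+2); last by lia.
apply: ok_if => h.
  by apply: (const true); [lia | rewrite cons0 (h : #|T| != 0)].
by apply: (const false); [lia | rewrite cons0 (h : #|T| == 0)].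
Qed.

Theorem mainTheorem15 :
  solvable_in (fun sigma k n => k ^ 3 * n ^ 2) /\
  solvable_in (fun sigma k n => sigma * k ^ 2 * n ^ 2).
Proof.
have H f : (forall (T : finType) k n (S : 'I_k -> seq T), (forall i, size (S i) = n) ->
    k ^ 2 * n ^ 2 <= f #|T| k n) -> solvable_in f.
  move=> hf; exists (compile 0 main_cmd ++ [:: IHalt]), 2000 => T k n D S hS.
  have [t [ht h]] := main_decides D hS; exists t; split=> //.
  (* The constant 7 is absorbed by the [+ 1] in the time bound, which matters when [f] vanishes. *)
  by apply: leq_trans ht _; have := hf T k n S hS; nia.
split; apply: H => T k n S hS.
  by rewrite leq_mul2r [k ^ 3]expnS -[leqLHS]mul1n leq_mul2r; case: k S hS; lia.
case: (posnP n) => [->|hn]; first by rewrite !muln0.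
case: (posnP k) => [->|hk]; first by rewrite muln0.
rewrite -mulnA -[leqLHS]mul1n leq_mul2r; apply/orP; right.
have := hS (Ordinal hk); case: (S _) => [h|x w _]; first by move: hn; rewrite -h.
by apply/card_gt0P; exists x.
Qed.
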